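(* Let $Q>1$. Let $X=(X,d_X,\mu_X)$ be a metric measure space such that: (i) $X$ is of locally $Q$-bounded geometry; (ii) there exists a continuous quasi-geodesic $\sigma:\mathbb{R}\to X$; (iii) there exist $R_0>0$, $N<Q$ and $C_0>0$ such that $\mu_X(B(\sigma(0),r))\le C_0 r^N$ for all $r\ge R_0$. Let $Y=(Y,d_Y,\mu_Y)$ be a metric measure space with Loewner function $\phi_Q$ such that: (iv) $Y$ is proper, i.e. its closed balls are compact; (v) $Y$ is of locally $Q$-bounded geometry; (vi) $\lim_{t\to 0}\phi_Q(t)=\infty$. Then $X$ and $Y$ are not quasiconformally equivalent, i.e. there is no quasiconformal map $f:X\to Y$.
   Context: A metric measure space $(X,d,\mu)$ is a metric space with a nontrivial Borel regular measure $\mu$; $B(x,r)$ denotes the ball of center $x$ and radius $r$. A continuum is a compact connected set. Quasiconformal map: a homeomorphism $f:X\to Y$ between metric spaces (onto $Y$) for which there is a finite constant $K\ge1$ with $$\limsup_{r\to0}\frac{\sup_{d_X(x,x')\le r}d_Y(f(x),f(x'))}{\inf_{d_X(x,x')\ge r}d_Y(f(x),f(x'))}\le K\quad\text{for all }x\in X.$$ Modulus: for a family $\Gamma$ of curves in $(X,d,\mu)$, a Borel function $\rho:X\to[0,\infty]$ is admissible, $\rho\in\mathrm{adm}(\Gamma)$, if $\int_\gamma\rho\,ds\ge1$ for all locally rectifiable $\gamma\in\Gamma$; the $Q$-modulus is $M_Q(\Gamma)=\inf_{\rho\in\mathrm{adm}(\Gamma)}\int\rho^Q\,d\mu$. For sets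 $E,F\subseteq X$, $\Gamma_{E,F}$ is the family of all continuous $\gamma:[0,1]\to X$ with $\gamma(0)\in E$, $\gamma(1)\in F$. Locally $Q$-bounded geometry ($Q>1$): $(X,d,\mu)$ is separable, pathwise connected, locally compact, and there exist a constant $C\ge1$ and a decreasing function $\phi:(0,\infty)\to(0,\infty)$ such that each point of $X$ has a neighbourhood $U$ with compact closure in $X$ so that (1) $\mu(B_R)\le C R^Q$ whenever $B_R\subset U$ is a ball of radius $R>0$; (2) $M_Q(\Gamma_{E,F})\ge\phi(t)$ whenever $B_R\subset U$ is a ball of radius $R>0$ and $E,F$ are two continua in $B_R$ with $0<\mathrm{dist}(E,F)\le t\cdot\min\{\mathrm{diam}E,\mathrm{diam}F\}$. Loewner function: $\phi_Q(t)=\inf M_Q(\Gamma_{E,F})$ for $t>0$, the infimum being over all continua $E,F$ in the space with $0<\mathrm{dist}(E,F)\le t\min\{\mathrm{diam}E,\mathrm{diam}F\}$. Quasi-geodesic: a (not necessarily continuous) map $\sigma:\mathbb{R}\to X$ for which there exist $L>0$, $b>0$ with $L^{-1}|t-t'|-b\le d_X(\sigma(t),\sigma(t'))\le L|t-t'|+b$ for all $t,t'\in\mathbb{R}$. *)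

(* Defs.v *)
From HB Require Import structures.
From mathcomp Require Import all_boot all_order all_algebra.
From mathcomp Require Import all_classical all_reals all_analysis.
From mathcomp Require Import measurable_realfun.

Set Implicit Arguments.
Unset Strict Implicit.
Unset Printing Implicit Defensive.

Import Order.TTheory GRing.Theory Num.Theory.
Import numFieldNormedType.Exports.

Local Open Scope classical_set_scope.
Local Open Scope ring_scope.

(* [measurableType] requires a [pointedType], so the spaces carry a base point.
   It plays no role besides forcing nonemptiness, which a nontrivial measure
   forces anyway. *)
#[short(type="pmetricType")]
HB.structure Definition PointedMetric (K : numDomainType) :=
  { M of Metric K M & Pointed M }.

Notation borel X := (g_sigma_algebraType (@open X)).

Section metric_notions.
Context {R : realType}.

Definition separable (X : topologicalType) :=
  exists2 S : set X, countable S & dense S.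

Definition continuum (X : topologicalType) (E : set X) :=
  compact E /\ connected E.

(* A curve [0,1] -> X is a function on R that is continuous on [0,1]; its values
   outside [0,1] are never used. *)
Definition is_curve (X : topologicalType) (gamma : R -> X) :=
  {within `[0, 1], continuous gamma}.

Definition pathwise_connected (X : topologicalType) :=
  forall x y : X, exists gamma : R -> X,
    [/\ is_curve gamma, gamma 0 = x & gamma 1 = y].

Definition connecting_curves (X : topologicalType) (E F : set X) :
    set (R -> X) :=
  [set gamma | [/\ is_curve gamma, E (gamma 0) & F (gamma 1)]].

(* The library's [closed_ball] is the closure of the open ball, which may be
   smaller than the closed ball in a general metric space. *)
Definition proper_metric (X : metricType R) :=
  forall (x : X) (r : R), compact [set y : X | mdist x y <= r].

(* With values in \bar R, the distance from the empty set is +oo and its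
   diameter is -oo. *)
Definition set_dist (X : metricType R) (E F : set X) : \bar R :=
  ereal_inf [set (mdist x.1 x.2)%:E | x in E `*` F].

Definition set_diam (X : metricType R) (E : set X) : \bar R :=
  ereal_sup [set (mdist x.1 x.2)%:E | x in E `*` E].

Definition quasi_geodesic (X : metricType R) (sigma : R -> X) :=
  exists L b : R, [/\ 0 < L, 0 < b & forall t t' : R,
    L^-1 * `|t - t'| - b <= mdist (sigma t) (sigma t') <= L * `|t - t'| + b].

Definition homeomorphism (X Y : topologicalType) (f : X -> Y) :=
  continuous f /\
  exists g : Y -> X, [/\ cancel f g, cancel g f & continuous g].

Definition distortion (X Y : metricType R) (f : X -> Y) (x : X) (r : R) :
    \bar R :=
  (ereal_sup [set (mdist (f x) (f x'))%:E | x' in [set x' | mdist x x' <= r]%R]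
  / ereal_inf [set (mdist (f x) (f x'))%:E | x' in [set x' | r <= mdist x x']%R]
  )%E.

Definition quasiconformal (X Y : metricType R) (f : X -> Y) :=
  homeomorphism f /\
  exists K : R, 1 <= K /\
    forall x : X, (limf_esup (distortion f x) 0^'+ <= K%:E)%E.

Section curves.
Context {X : metricType R}.
Implicit Type gamma : R -> X.

Definition polygonal_length gamma (a : R) (s : seq R) : R :=
  \sum_(0 <= i < size s)
    mdist (gamma (nth a (a :: s) i)) (gamma (nth a (a :: s) i.+1)).

Definition curve_length gamma (a b : R) : \bar R :=
  ereal_sup [set (polygonal_length gamma a s)%:E | s in itv_partition a b].

Definition locally_rectifiable gamma :=
  forall a b : R, 0 <= a -> a <= b -> b <= 1 ->
    (curve_length gamma a b < +oo)%E.

(* For a rectifiable curve this is the unique map gamma_s on [0, length] with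
   gamma t = gamma_s (length of gamma on [0,t]): all t chosen by [xget] have the
   same image by gamma. *)
Definition arc_length_param gamma (s : R) : X :=
  gamma (xget 0 [set t : R | 0 <= t <= 1 /\ curve_length gamma 0 t = s%:E]).

Definition line_integral (rho : X -> \bar R) gamma : \bar R :=
  (\int[lebesgue_measure]_(s in `[0%R, fine (curve_length gamma 0 1)])
     rho (arc_length_param gamma s))%E.

End curves.

End metric_notions.

Section metric_measure.
Context {R : realType} {X : pmetricType R}.
Implicit Types (mu : {outer_measure set X -> \bar R}) (Q : R).

(* As usual for Borel regular measures, a measure is defined on all subsets
   (an outer measure). *)
Definition borel_regular mu :=
  (forall A : set (borel X), measurable A -> mu.-caratheodory A) /\
  (forall A : set X, exists B : set (borel X),
    [/\ measurable B, A `<=` B & mu B = mu A]).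

Definition metric_measure_space mu := borel_regular mu /\ (0 < mu setT)%E.

Definition admissible (Gamma : set (R -> X)) : set (X -> \bar R) :=
  [set rho : X -> \bar R | [/\ measurable_fun [set: borel X] rho,
    forall x, (0 <= rho x)%E &
    forall gamma, Gamma gamma -> locally_rectifiable gamma ->
      (1 <= line_integral rho gamma)%E]].

Definition modulus mu Q (Gamma : set (R -> X)) : \bar R :=
  ereal_inf [set (\int[(mu : set (borel X) -> \bar R)]_(x in [set: borel X])
                    poweR (rho x) Q)%E | rho in admissible Gamma].

Definition relatively_close (t : R) (E F : set X) :=
  (0 < set_dist E F)%E /\
  (set_dist E F <= t%:E * Order.min (set_diam E) (set_diam F))%E.

Definition locally_bounded_geometry mu Q :=
  [/\ separable X, @pathwise_connected R X, locally_compact [set: X] &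
  exists (C : R) (phi : R -> R),
  [/\ 1 <= C,
      forall t : R, 0 < t -> 0 < phi t,
      forall s t : R, 0 < s -> s <= t -> phi t <= phi s &
      forall x : X, exists U : set X,
      [/\ nbhs x U, compact (closure U),
          forall (y : X) (r : R), 0 < r -> ball y r `<=` U ->
            (mu (ball y r) <= (C * r `^ Q)%:E)%E &
          forall (y : X) (r : R) (E F : set X) (t : R),
            0 < r -> ball y r `<=` U ->
            continuum E -> continuum F ->
            E `<=` ball y r -> F `<=` ball y r ->
            0 < t -> relatively_close t E F ->
            ((phi t)%:E <= modulus mu Q (connecting_curves E F))%E]]].

Definition loewner_function mu Q (t : R) : \bar R :=
  ereal_inf [set m | exists E F : set X,
    [/\ continuum E, continuum F, relatively_close t E F &
        m = modulus mu Q (connecting_curves E F)]].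

End metric_measure.

(* Main.v *)
Require Import Defs.
From HB Require Import structures.
From mathcomp Require Import all_boot all_order all_algebra.
From mathcomp Require Import all_classical all_reals all_analysis.
From mathcomp Require Import measurable_realfun ring lra.

Set Implicit Arguments.
Unset Strict Implicit.
Unset Printing Implicit Defensive.

Import Order.TTheory GRing.Theory Num.Theory.
Import numFieldNormedType.Exports.

Local Open Scope classical_set_scope.
Local Open Scope ring_scope.

(** The two ends of the quasi-geodesic [sigma] in [X] are seen very differently
    by the Q-modulus in [X] and in [Y], and a quasiconformal map cannot
    reconcile the two pictures.

    In [X] the mass of balls about [sigma 0] grows slower than [r^Q].  There is
    a function [v] that vanishes on [sigma (-oo, -T]], is at least 1 on
    [sigma [T, +oo)], and has Lipschitz constant [w x] of order
    [1 / max (d (sigma 0, x)) T] at [x]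
    ([quasi_geodesic_separating_function]); the integral of [w^Q] is finite
    ([packing_bound_growth]).  So the family of curves joining [sigma [-S, -T]]
    to [sigma [T, S]] has Q-modulus bounded independently of [S].  In [Y], which
    is proper, the images of these two arcs have diameters tending to infinity
    with [S] while their distance stays bounded; since the Loewner function
    tends to infinity at 0, the Q-modulus of the curves joining the images is
    unbounded.

    What remains is to bound the modulus in [Y] by the integral of [w^Q] in [X]
    for a quasiconformal [f : X -> Y] ([quasiconformal_modulus_le]).  The metric
    definition gives, at each point [x] and for small radii, that
    [d (x, x2) <= d (x, x1)] implies [d (f x, f x2) <= K d (f x, f x1)].
    Read in [Y], this says that the preimage of [B(f x, t)] has outer radius at
    most the inner radius of the preimage of [B(f x, 2 K t)].  Comparing all
    scales, at every point there are arbitrarily small [s] such that the preimage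
    of [B(f x, 6 s)] either has outer radius [A] comparable with the inner radius
    of the preimage of [B(f x, s)], or is as small as desired compared with [s]
    ([round_or_small_preimage]).  Vitali's lemma extracts from the balls
    [B(y, s)] a disjoint sequence whose triples cover [Y], and the Q-norm of the
    family of functions [2 w A / s] on [B(y, 6 s)] is admissible.  By the bounds
    [c r^Q <= mu (B(x, r)) <= C r^Q] at small scales ([ball_mass_bounds]), its
    Q-th power has integral at most a constant times the sum of [w^Q] times the
    masses of disjoint balls of [X], plus a finite contribution of the
    second kind of preimages.

    Admissibility is checked along the arc length parametrization by a greedy
    walk ([greedy_integral_bound]) whose steps do not overlap, so that the
    overlaps of the enlarged balls do no harm. *)

(** * Length of curves *)

Section arc_length.
Context {R : realType} {X : metricType R}.
Implicit Types (gamma : R -> X) (s : seq R) (a b c : R).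

(** Recursive form of [polygonal_length], suited to induction on the partition. *)
Fixpoint chain_length gamma a s : R :=
  if s is x :: s' then mdist (gamma a) (gamma x) + chain_length gamma x s'
  else 0.

Lemma polygonal_lengthE gamma a s :
  polygonal_length gamma a s = chain_length gamma a s.
Proof.
rewrite /polygonal_length; have : (size s <= size s)%N by [].
move: {1 3}a; elim: s a => [|x s IH] a d /= _; first by rewrite big_geq.
rewrite big_nat_recl//=; congr (_ + _).
rewrite -(IH x d)//.
Qed.

Lemma chain_length_ge0 gamma a s : 0 <= chain_length gamma a s.
Proof. by elim: s a => //= x s IH a; rewrite addr_ge0 ?mdist_ge0. Qed.

Lemma chain_length_cat gamma a s s' : chain_length gamma a (s ++ s') =
  chain_length gamma a s + chain_length gamma (last a s) s'.
Proof. by elim: s a => [|x s IH] a /=; rewrite ?add0r// IH addrA. Qed.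

Lemma chain_length_le gamma a b s : itv_partition a b s ->
  ((chain_length gamma a s)%:E <= curve_length gamma a b)%E.
Proof.
move=> abs; apply: ereal_sup_ubound; exists s => //.
by rewrite polygonal_lengthE.
Qed.

Lemma curve_length_le gamma a b M :
  (forall s, itv_partition a b s -> chain_length gamma a s <= M) ->
  (curve_length gamma a b <= M%:E)%E.
Proof.
move=> H; apply: ge_ereal_sup => _ [s abs <-].
by rewrite polygonal_lengthE lee_fin; exact: H.
Qed.

Lemma itv_partition_ex a b : a <= b -> exists s, itv_partition a b s.
Proof.
rewrite le_eqVlt => /predU1P[->|ab]; first by exists [::]; split => /=.
by exists [:: b]; exact: itv_partition1.
Qed.

Lemma curve_length_ge0 gamma a b : a <= b -> (0 <= curve_length gamma a b)%E.
Proof.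
move=> /itv_partition_ex[s abs]; apply: le_trans (chain_length_le gamma abs).
by rewrite lee_fin chain_length_ge0.
Qed.

Lemma mdist_le_curve_length gamma a b : a <= b ->
  ((mdist (gamma a) (gamma b))%:E <= curve_length gamma a b)%E.
Proof.
rewrite le_eqVlt => /predU1P[->|ab]; first by rewrite mdistxx curve_length_ge0.
by have := chain_length_le gamma (itv_partition1 ab); rewrite /= addr0.
Qed.

Lemma curve_length_approx gamma a b e : a <= b -> 0 < e ->
  (curve_length gamma a b < +oo)%E ->
  exists2 s, itv_partition a b s &
    (curve_length gamma a b < (chain_length gamma a s + e)%:E)%E.
Proof.
move=> ab e0 fl.
have fn : curve_length gamma a b \is a fin_num.
  by rewrite ge0_fin_numE// curve_length_ge0.
have [_ [s abs <-]] := ub_ereal_sup_adherent e0 fn.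
rewrite polygonal_lengthE lteBlDr // -EFinD => H.
by exists s.
Qed.

Lemma curve_length_superadd gamma a b c : a <= b -> b <= c ->
  (curve_length gamma a c < +oo)%E ->
  (curve_length gamma a b + curve_length gamma b c <= curve_length gamma a c)%E.
Proof.
move=> ab bc fl.
have fn : curve_length gamma a c \is a fin_num.
  by rewrite ge0_fin_numE// curve_length_ge0// (le_trans ab).
have key s : itv_partition a b s ->
    ((chain_length gamma a s)%:E + curve_length gamma b c
      <= curve_length gamma a c)%E.
  move=> abs; rewrite -leeBrDl//.
  apply: ge_ereal_sup => _ [t bct <-]; rewrite polygonal_lengthE leeBrDl//.
  rewrite -EFinD; apply: le_trans (chain_length_le gamma (itv_partition_cat abs bct)).
  by rewrite chain_length_cat; case: abs => _ /eqP ->.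
have [s0 abs0] := itv_partition_ex ab.
have fnb : curve_length gamma b c \is a fin_num.
  rewrite ge0_fin_numE ?curve_length_ge0//; apply: le_lt_trans fl.
  apply: le_trans (key _ abs0); rewrite leeDr// lee_fin.
  exact: chain_length_ge0.
rewrite -leeBrDr//; apply: ge_ereal_sup => _ [t bct <-].
by rewrite leeBrDr// polygonal_lengthE; exact: key.
Qed.

(** Inserting the vertex [b] does not shorten the chain, by the triangle
    inequality. *)
Lemma partition_split gamma a b c s : a <= b -> b <= c -> itv_partition a c s ->
  exists s1 s2, [/\ itv_partition a b s1, itv_partition b c s2 &
    chain_length gamma a s <= chain_length gamma a s1 + chain_length gamma b s2].
Proof.
elim: s a => [|x s IH] a ab bc abs.
  have ac := itv_partition_nil abs; subst c.
  have -> : b = a by apply/eqP; rewrite eq_le ab bc.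
  by exists [::], [::]; split => //=; rewrite addr0.
have [xb|bx] := leP x b.
  have [s1 [s2 [p1 p2 H]]] := IH x xb bc (itv_partition_cons abs).
  exists (x :: s1), s2; split => //.
    case: abs => /= /andP[ax _] _; case: p1 => p1 l1.
    by split => //=; rewrite ax.
  by rewrite /= -addrA lerD2l.
have p2 : itv_partition b c (x :: s).
  by case: abs => /= /andP[ax xs] lc; split => //=; rewrite bx.
move: ab; rewrite le_eqVlt => /predU1P[ab|ab].
  by subst b; exists [::], (x :: s); split => //=; rewrite add0r.
exists [:: b], (x :: s); split => //; first exact: itv_partition1.
by rewrite /= addr0 addrA lerD2r metric_triangle.
Qed.

Lemma curve_length_subadd gamma a b c : a <= b -> b <= c ->
  (curve_length gamma a c <= curve_length gamma a b + curve_length gamma b c)%E.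
Proof.
move=> ab bc; apply: ge_ereal_sup => _ [s abs <-].
rewrite polygonal_lengthE.
have [s1 [s2 [p1 p2 H]]] := partition_split gamma ab bc abs.
apply: (@le_trans _ _ ((chain_length gamma a s1)%:E + (chain_length gamma b s2)%:E)%E).
  by rewrite -EFinD lee_fin.
by apply: leeD; exact: chain_length_le.
Qed.

End arc_length.

(** * Arc length parametrization *)

Section arc_length_parametrization.
Context {R : realType} {X : metricType R}.
Implicit Types (gamma : R -> X).

Lemma is_curve_dist gamma t e : is_curve gamma -> 0 <= t <= 1 -> 0 < e ->
  exists2 d, 0 < d & forall u, 0 <= u <= 1 -> `|t - u| < d ->
    mdist (gamma t) (gamma u) < e.
Proof.
move=> /subspace_continuousP gc t01 e0.
have /gc/metricType_numDomainType.cvgrPdist_lt/(_ _ e0) : `[0, 1]%classic t by rewrite /= in_itv.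
rewrite near_withinE => /nbhs_ballP[d /= d0 H]; exists d => // u u01 tud.
by apply: H => //=; rewrite in_itv.
Qed.

Variable gamma : R -> X.
Hypotheses (gc : is_curve gamma) (gr : locally_rectifiable gamma).

Let V t := fine (curve_length gamma 0 t).

Lemma curve_length_fin a b : 0 <= a -> a <= b -> b <= 1 ->
  curve_length gamma a b = (fine (curve_length gamma a b))%:E.
Proof.
move=> a0 ab b1; rewrite fineK// ge0_fin_numE ?curve_length_ge0//.
exact: gr.
Qed.

Lemma curve_length_incr t u : 0 <= t -> t <= u -> u <= 1 ->
  V t + mdist (gamma t) (gamma u) <= V u.
Proof.
move=> t0 tu u1; have t1 := le_trans tu u1; have u0 := le_trans t0 tu.
rewrite -lee_fin EFinD /V -(curve_length_fin (lexx 0) t0 t1).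
rewrite -(curve_length_fin (lexx 0) u0 u1).
apply: le_trans (curve_length_superadd t0 tu (gr (lexx 0) u0 u1)).
by rewrite leeD2l// mdist_le_curve_length.
Qed.

(** Moving the last vertex of an almost optimal partition of [0, t] slightly
    to the left costs little, by continuity of [gamma]. *)
Lemma curve_length_left_limit t M : 0 <= t -> t <= 1 -> 0 <= M ->
  (forall d, 0 < d -> exists u, [/\ 0 <= u, u <= t, t - u < d & V u <= M]) ->
  V t <= M.
Proof.
move=> t0 t1 M0 H; rewrite -lee_fin -curve_length_fin//.
apply: curve_length_le => s; case/lastP: s => [|s x] //= ps.
have := ps; case => + /eqP; rewrite last_rcons rcons_path => /andP[p1 lx] xt.
subst x; rewrite -cats1 chain_length_cat /= addr0.
apply/ler_addgt0Pl => e e0.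
have t01 : 0 <= t <= 1 by rewrite t0.
have [d d0 Hd] := is_curve_dist gc t01 e0.
pose p := last 0 s.
have p0 : 0 <= p by apply: (@itv_partition_le _ _ 0 p s); split.
have dp : 0 < Num.min d (t - p) by rewrite lt_min d0 subr_gt0.
have [u [u0 ut tu Vu]] := H _ dp.
move: tu; rewrite lt_min => /andP[tud tup].
have pu : p < u by lra.
have u1 : u <= 1 by exact: le_trans t1.
have ps' : itv_partition 0 u (rcons s u).
  by split; rewrite ?last_rcons// rcons_path p1.
have := chain_length_le gamma ps'.
rewrite curve_length_fin// lee_fin -cats1 chain_length_cat /= addr0 -/(V u) => Hu.
have tu : `|t - u| < d by rewrite ger0_norm// subr_ge0.
have := Hd u _ tu; rewrite u0 u1 => /(_ isT) Hdist.
have := metric_triangle (gamma p) (gamma u) (gamma t).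
rewrite (metric_sym (gamma u)) -/p in Hu *.
by rewrite -/p => Htri; lra.
Qed.

(** The first vertex after [t] of an almost optimal partition of [t, 1] can be
    preceded by a point close to [t], so short initial pieces have small
    length. *)
Lemma curve_length_right_limit t e : 0 <= t -> t < 1 -> 0 < e ->
  exists2 u, t < u <= 1 & V u <= V t + e.
Proof.
move=> t0 t1 e0.
have e20 : 0 < e / 2 by rewrite divr_gt0.
have [s ps Hs] := curve_length_approx (ltW t1) e20 (gr t0 (ltW t1) (lexx _)).
have t01 : 0 <= t <= 1 by rewrite t0 ltW.
have [d d0 Hd] := is_curve_dist gc t01 e20.
case: s ps Hs => [/itv_partition_nil t1'|p s ps Hs]; first by move: t1; rewrite t1' ltxx.
have tp : t < p by case: ps => /= /andP[].
have p1 : p <= 1 := itv_partition_le (itv_partition_cons ps).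
pose u := Num.min p (t + d / 2).
have tu : t < u by rewrite lt_min tp ltrDl divr_gt0.
have up : u <= p by rewrite ge_min lexx.
have ud : u <= t + d / 2 by rewrite ge_min lexx orbT.
have u1 : u <= 1 by exact: le_trans p1.
have u0 : 0 <= u by rewrite (le_trans t0)// ltW.
exists u; first by rewrite tu.
have {}Hd : mdist (gamma t) (gamma u) < e / 2.
  apply: Hd; first by rewrite u0.
  rewrite ltr0_norm ?subr_lt0// opprB; lra.
have H1 : (curve_length gamma t 1 <=
    (mdist (gamma t) (gamma u))%:E + curve_length gamma u 1 + (e / 2)%:E)%E.
  apply/ltW/(lt_le_trans Hs); rewrite EFinD leeD2r//=.
  apply: (@le_trans _ _ ((mdist (gamma t) (gamma u))%:E
      + ((mdist (gamma u) (gamma p))%:E + (chain_length gamma p s)%:E))%E).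
    by rewrite -!EFinD lee_fin addrA lerD2r metric_triangle.
  rewrite leeD2l//.
  apply: le_trans (curve_length_superadd up p1 (gr u0 u1 (lexx _))).
  by rewrite leeD ?mdist_le_curve_length ?chain_length_le//; exact: itv_partition_cons ps.
have H2 := curve_length_superadd (ltW tu) u1 (gr t0 (ltW t1) (lexx _)).
have H3 := curve_length_subadd gamma t0 (ltW tu).
move: H1 H2 H3.
rewrite (curve_length_fin t0 (ltW t1) (lexx _)) (curve_length_fin u0 u1 (lexx _)).
rewrite (curve_length_fin t0 (ltW tu) u1) (curve_length_fin (lexx 0) u0 u1).
rewrite (curve_length_fin (lexx 0) t0 (ltW t1)) -!EFinD !lee_fin -/(V u) -/(V t).
by move=> *; lra.
Qed.

(** The length is a continuous function of the endpoint, hence takes all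
    intermediate values; without this, [arc_length_param] would be constant on
    the gaps. *)
Lemma curve_length_attained s : 0 <= s -> s <= V 1 ->
  exists2 t, 0 <= t <= 1 & curve_length gamma 0 t = s%:E.
Proof.
move=> s0 sl.
pose A := [set t | 0 <= t <= 1 /\ V t <= s].
have V0 : V 0 = 0.
  rewrite /V (_ : curve_length _ _ _ = 0%:E)//; apply/eqP; rewrite eq_le curve_length_ge0// andbT.
  by apply: curve_length_le => p /itv_partitionxx ->.
have A0 : A 0 by split; rewrite ?lexx ?ler01// V0.
have supA : has_sup A by split; [exists 0 | exists 1 => t [/andP[]]].
pose t := sup A.
have t0 : 0 <= t by apply: ub_le_sup => //; case: supA.
have t1 : t <= 1 by apply: ge_sup; [exists 0 | move=> u [/andP[]]].
have Vt : V t <= s.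
  apply: curve_length_left_limit => // d d0.
  have [u [/andP[u0 u1] Vu] Hu] := sup_adherent d0 supA.
  exists u; split => //; first by apply: ub_le_sup; [case: supA | split => //; rewrite u0].
  by rewrite -/t in Hu; lra.
exists t; first by rewrite t0.
rewrite curve_length_fin// -/(V t); congr EFin; apply/eqP; rewrite eq_le Vt /=.
move: t1; rewrite le_eqVlt => /predU1P[->//|t1].
rewrite leNgt; apply/negP => Vts.
have e0 : 0 < s - V t by rewrite subr_gt0.
have [u /andP[tu u1] Vu] := curve_length_right_limit t0 t1 e0.
suff /(lt_le_trans tu) : u <= t by rewrite ltxx.
apply: ub_le_sup; first by case: supA.
by split; [rewrite u1 (le_trans t0)// ltW | lra].
Qed.

Let l := fine (curve_length gamma 0 1).

Lemma arc_length_paramP s : 0 <= s <= l ->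
  exists t, [/\ 0 <= t <= 1, V t = s & arc_length_param gamma s = gamma t].
Proof.
move=> /andP[s0 sl]; have [t t01 Vt] := curve_length_attained s0 sl.
pose P := [set t : R | 0 <= t <= 1 /\ curve_length gamma 0 t = s%:E].
have [] : P (xget 0 P) by apply: xgetPex; exists t.
by move=> H1 H2; exists (xget 0 P); rewrite /V H2.
Qed.

Lemma arc_length_param_lip a b : 0 <= a <= l -> 0 <= b <= l ->
  mdist (arc_length_param gamma a) (arc_length_param gamma b) <= `|a - b|.
Proof.
move=> /arc_length_paramP[t [/andP[t0 t1] Vt ->]].
move=> /arc_length_paramP[u [/andP[u0 u1] Vu ->]].
have [tu|ut] := leP t u.
  have := curve_length_incr t0 tu u1; rewrite Vt Vu => H.
  by rewrite distrC (le_trans _ (ler_norm _))// lerBrDl.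
have := curve_length_incr u0 (ltW ut) t1; rewrite Vt Vu => H.
by rewrite metric_sym (le_trans _ (ler_norm _))// lerBrDl.
Qed.

Lemma length_ge0 : 0 <= l. Proof. by rewrite fine_ge0// curve_length_ge0. Qed.

Lemma arc_length_param0 : arc_length_param gamma 0 = gamma 0.
Proof.
have l00 : 0 <= (0 : R) <= l by rewrite lexx length_ge0.
have [t [/andP[t0 t1] Vt ->]] := arc_length_paramP l00.
have := curve_length_incr (lexx 0) t0 t1; rewrite Vt => H.
have V0 : 0 <= V 0 by rewrite fine_ge0// curve_length_ge0.
apply/esym/mdist_positivity/eqP; rewrite eq_le mdist_ge0 andbT.
by lra.
Qed.

Lemma arc_length_param1 : arc_length_param gamma l = gamma 1.
Proof.
have ll : 0 <= l <= l by rewrite lexx length_ge0.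
have [t [/andP[t0 t1] Vt ->]] := arc_length_paramP ll.
have := curve_length_incr t0 t1 (lexx 1); rewrite Vt -[V 1]/l => H.
apply/mdist_positivity/eqP; rewrite eq_le mdist_ge0 andbT.
by lra.
Qed.

Lemma mdist_le_length : mdist (gamma 0) (gamma 1) <= l.
Proof.
rewrite -arc_length_param0 -arc_length_param1.
have := @arc_length_param_lip 0 l; rewrite !lexx length_ge0 => /(_ isT isT).
by rewrite sub0r normrN ger0_norm// length_ge0.
Qed.

End arc_length_parametrization.

(** * A greedy lower bound for integrals on an interval *)

Section greedy_integral.
Context {R : realType}.
Variables (l : R) (phi : R -> \bar R) (h : R -> R).
Hypotheses (l0 : 0 <= l) (mphi : measurable_fun `[0, l] phi).
Hypothesis phi0 : forall s, (0 <= phi s)%E.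
Hypothesis hc : forall s e : R, 0 <= s <= l -> 0 < e ->
  exists2 d : R, 0 < d & forall s' : R, 0 <= s' <= l -> `|s - s'| < d ->
    `|h s - h s'| < e.

Let mu := @lebesgue_measure R.
Let F (s : R) := (\int[mu]_(x in `[0%R, s]) phi x)%E.

Lemma integral_itv_ge a b c : 0 <= a -> a <= b -> b <= l -> 0 <= c ->
  (forall s : R, a <= s <= b -> (c%:E <= phi s)%E) ->
  ((c * (b - a))%:E <= \int[mu]_(x in `]a, b]) phi x)%E.
Proof.
move=> a0 ab bl c0 H.
apply: (@le_trans _ _ (\int[mu]_(x in `]a, b]) cst c%:E x)%E); last first.
  apply: ge0_le_integral => //.
  - apply: measurable_funS mphi => // x /=; rewrite !in_itv /= => /andP[ax xb].
    by rewrite (le_trans a0 (ltW ax)) (le_trans xb).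
  - by move=> x; rewrite /= in_itv /= => /andP[ax xb]; apply: H; rewrite xb ltW.
rewrite integral_cst//= lebesgue_measure_itv/= lte_fin.
case: ifP => [_|/negbT]; first by rewrite EFinM EFinB.
rewrite -leNgt => ba.
by rewrite mule0 lee_fin (_ : b = a) ?subrr ?mulr0//; apply/eqP; rewrite eq_le ba.
Qed.

Lemma integral_itv_split a b : 0 <= a -> a <= b -> b <= l ->
  (F b = F a + \int[mu]_(x in `]a, b]) phi x)%E.
Proof.
move=> a0 ab bl; rewrite /F (@itv_bndbnd_setU _ _ _ (BRight a))// ge0_integral_setU//.
- rewrite -itv_bndbnd_setU//.
  apply: measurable_funS mphi => // x /=; rewrite !in_itv /= => /andP[-> xb].
  by rewrite (le_trans xb).
- rewrite disj_set2E; apply/eqP/seteqP; split => // x [] /=.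
  by rewrite !in_itv /= => /andP[_ xa] /andP[]; rewrite ltNge xa.
Qed.

(** Walking along [0, l] greedily: from [s] jump to [s + r].  The supremum of
    the points reachable with the expected bound is reachable by continuity of
    [h], and cannot be less than [l - r].  The factor 2 pays for the last jump,
    whose interval has to be shifted back inside [0, l]. *)
Lemma greedy_integral_bound :
  (forall s : R, 0 <= s <= l -> exists r a : R, [/\ 0 < r, r <= l, 0 <= a &
     forall s' : R, 0 <= s' <= l -> `|s' - s| <= r ->
       (a%:E <= phi s')%E /\ `|h s' - h s| <= a * r]) ->
  (`|h l - h 0|%:E <= 2%:E * F l)%E.
Proof.
move=> H.
have Fge0 s : (0 <= F s)%E by exact: integral_ge0.
have [Flty|] := ltP (F l) +oo%E; last first.
  by rewrite leye_eq => /eqP ->; rewrite mulry gtr0_sg// mul1e leey.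
have Fmono a b : 0 <= a -> a <= b -> b <= l -> (F a <= F b)%E.
  by move=> a0 ab bl; rewrite (integral_itv_split a0 ab bl) leeDl// integral_ge0.
have Ffin s : 0 <= s -> s <= l -> F s = (fine (F s))%:E.
  move=> s0 sl; rewrite fineK// ge0_fin_numE//; apply: le_lt_trans Flty.
  exact: Fmono.
pose f s := fine (F s).
have fmono a b : 0 <= a -> a <= b -> b <= l -> f a <= f b.
  move=> a0 ab bl; have := Fmono _ _ a0 ab bl.
  by rewrite (Ffin a a0 (le_trans ab bl)) (Ffin b (le_trans a0 ab) bl) lee_fin.
have fge0 s : 0 <= f s by exact: fine_ge0.
have fjump a b c : 0 <= a -> a <= b -> b <= l -> 0 <= c ->
    (forall s : R, a <= s <= b -> (c%:E <= phi s)%E) -> f a + c * (b - a) <= f b.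
  move=> a0 ab bl c0 Hc.
  rewrite -lee_fin EFinD -(Ffin a a0 (le_trans ab bl)) -(Ffin b (le_trans a0 ab) bl).
  by rewrite (integral_itv_split a0 ab bl) leeD2l// integral_itv_ge.
rewrite (Ffin l l0 (lexx _)) -EFinM lee_fin -/(f l).
pose A := [set s | 0 <= s <= l /\ `|h s - h 0| <= f s].
have A0 : A 0 by split; rewrite ?lexx ?l0// subrr normr0.
have supA : has_sup A by split; [exists 0 | exists l => t [/andP[]]].
pose t := sup A.
have t0 : 0 <= t by apply: ub_le_sup => //; case: supA.
have tl : t <= l by apply: ge_sup; [exists 0 | move=> u [/andP[]]].
have t0l : 0 <= t <= l by rewrite t0.
have At : `|h t - h 0| <= f t.
  apply/ler_addgt0Pl => e e0; have [d d0 Hd] := hc t0l e0.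
  have [u [/andP[u0 ul] Hu] tu] := sup_adherent d0 supA.
  have ut : u <= t.
    by apply: ub_le_sup; [case: supA | split => //; rewrite u0].
  have := Hd u; rewrite u0 ul => /(_ isT); rewrite ger0_norm ?subr_ge0//.
  rewrite -/t in tu; have -> : t - u < d by lra.
  move=> /(_ isT) Htu; have := fmono _ _ u0 ut tl.
  have := ler_distD (h u) (h t) (h 0); lra.
have [r [a [r0 rl a0 Hr]]] := H t t0l.
have [trl|ltr] := leP (t + r) l.
  suff : t + r <= t by lra.
  have tr0 : 0 <= t + r by lra.
  apply: ub_le_sup; first by case: supA.
  split; first by rewrite tr0.
  have [] := Hr (t + r); rewrite ?tr0//; first by rewrite addrC addKr gtr0_norm.
  move=> _ Htr.
  have := fjump t (t + r) a t0 _ trl a0.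
  rewrite lerDl (ltW r0) => /(_ isT).
  have -> : t + r - t = r by lra.
  have Hb (s : R) : t <= s <= t + r -> (a%:E <= phi s)%E.
    move=> /andP[ts sr]; apply: (Hr s _ _).1; first by apply/andP; split; lra.
    by rewrite ger0_norm; lra.
  move=> /(_ Hb) Hf.
  by have := ler_distD (h t) (h (t + r)) (h 0); lra.
have ll : 0 <= l <= l by rewrite l0 lexx.
have tl' : `|l - t| <= r by rewrite ger0_norm; lra.
have [_ Hl] := Hr l ll tl'.
have Hb (s : R) : 0 <= s <= l -> t - r <= s -> (a%:E <= phi s)%E.
  by move=> sl tr; apply: (Hr s _ _).1 => //; rewrite ler_norml; lra.
have har : a * r <= f l.
  have [rt|tr] := leP r t.
    have tr0 : 0 <= t - r by lra.
    have := @fjump (t - r) t a tr0; rewrite gerBl (ltW r0) => /(_ isT tl a0).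
    have -> : t - (t - r) = r by lra.
    move=> Hf; have := fge0 (t - r); have := fmono _ _ t0 tl (lexx _).
    suff : f (t - r) + a * r <= f t by lra.
    by apply: Hf => // s /andP[s1 s2]; apply: Hb; rewrite ?(le_trans tr0 s1) ?(le_trans s2 tl).
  have := @fjump 0 l a (lexx _) l0 (lexx _) a0.
  rewrite subr0 => Hf; have {}Hf : f 0 + a * l <= f l.
    by apply: Hf => s s01; apply: Hb => //; case/andP: s01 => s1 s2; lra.
  have := fge0 0; have : a * r <= a * l by rewrite ler_wpM2l.
  by lra.
have := ler_distD (h t) (h l) (h 0); have := fmono _ _ t0 tl (lexx _).
by lra.
Qed.

End greedy_integral.

(** * Line integrals and oscillation *)

Section line_integrals.
Context {R : realType} {X : pmetricType R}.
Implicit Types (gamma : R -> X) (rho : X -> \bar R) (u : X -> R).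

Lemma measurable_arc_length_param gamma : is_curve gamma ->
  locally_rectifiable gamma ->
  measurable_fun `[0, fine (curve_length gamma 0 1)]
    (arc_length_param gamma : R -> borel X).
Proof.
move=> gc gr; set l := fine _.
have l0 : 0 <= l by exact: length_ge0.
pose clamp (s : R) : R := Num.max 0 (Num.min s l).
have clampP s : 0 <= clamp s <= l.
  by rewrite le_max lexx ge_max l0 ge_min lexx orbT.
have clampE s : 0 <= s <= l -> clamp s = s.
  by move=> /andP[s0 sl]; rewrite /clamp (min_idPl sl) (max_idPr s0).
have clampL s t : `|clamp s - clamp t| <= `|s - t|.
  have H (a b c d : R) : (a - b <= `|c - d|) -> (b - a <= `|c - d|) ->
      `|a - b| <= `|c - d|.
    by move=> ab ba; rewrite ler_norml ab andbT lerNl opprB.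
  have := ler_norm (s - t); have := ler_norm (t - s); rewrite (distrC t) => H1 H2.
  apply: (@le_trans _ _ `|Num.min s l - Num.min t l|).
    have := ler_norm (Num.min s l - Num.min t l).
    have := ler_norm (Num.min t l - Num.min s l); rewrite (distrC (Num.min t l)).
    rewrite /clamp; case: (leP 0 (Num.min s l)); case: (leP 0 (Num.min t l)) => *;
      apply: H; lra.
  by case: (leP s l); case: (leP t l) => *; apply: H; lra.
have cont : continuous (arc_length_param gamma \o clamp).
  move=> s; apply/metricType_numDomainType.cvgrPdist_lt => e e0.
  apply/nbhs_ballP; exists e => // t /= st.
  by apply: le_lt_trans st; rewrite (le_trans (arc_length_param_lip gc gr _ _)).
apply: (@measurability _ _ (measurableTypeR R) (borel X) _ _ (@open X)).
  by [].
move=> _ [B oB <-].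
have -> : `[0, l] `&` arc_length_param gamma @^-1` B =
    `[0, l]%classic `&` (arc_length_param gamma \o clamp) @^-1` B.
  apply/seteqP; split => s [] /=; rewrite in_itv /= => sl.
    by rewrite clampE.
  by rewrite clampE.
apply: measurableI => //; apply: open_measurable.
by apply: open_comp => // s _; exact: cont.
Qed.

(** A density [rho] controls the oscillation of [u] along a rectifiable curve
    as soon as it does so at one scale, which may depend on the point, in terms
    of a constant lower bound of [rho]. *)
Lemma line_integral_oscillation gamma rho u : is_curve gamma ->
  locally_rectifiable gamma -> measurable_fun [set: borel X] rho ->
  (forall x, (0 <= rho x)%E) -> continuous u ->
  (forall x, exists r a : R, [/\ 0 < r, r <= mdist (gamma 0) (gamma 1), 0 <= a &
     forall x', mdist x x' <= r -> (a%:E <= rho x')%E /\ `|u x' - u x| <= a * r]) ->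
  (`|u (gamma 1) - u (gamma 0)|%:E <= 2%:E * line_integral rho gamma)%E.
Proof.
move=> gc gr mrho rho0 uc H; set l := fine (curve_length gamma 0 1).
have l0 : 0 <= l by exact: length_ge0.
rewrite -(arc_length_param0 gc gr) -(arc_length_param1 gc gr).
have -> : line_integral rho gamma = (\int[lebesgue_measure]_(s in `[0%R, l])
   (rho \o arc_length_param gamma) s)%E by [].
apply: (@greedy_integral_bound _ l _ (u \o arc_length_param gamma)) => //.
- apply: (@measurable_comp _ _ _ _ _ _ [set: borel X]) => //.
  exact: measurable_arc_length_param.
- move=> s /=; exact: rho0.
- move=> s e sl e0.
  have /cvgrPdist_lt/(_ _ e0)/nbhs_ballP[d d0 Hd] := uc (arc_length_param gamma s).
  exists d => // s' sl' ss'; apply: Hd; rewrite ballEmdist /=.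
  by apply: le_lt_trans ss'; exact: arc_length_param_lip.
- move=> s sl; have [r [a [r0 rl a0 Hr]]] := H (arc_length_param gamma s).
  exists r, a; split => //; first exact: le_trans (mdist_le_length gc gr).
  move=> s' sl' ss'; apply: Hr; rewrite (le_trans (arc_length_param_lip gc gr _ _))//.
  by rewrite distrC.
Qed.

End line_integrals.

(** * Borel measures and densities built from balls *)

Section borel_measure.
Context {R : realType} {X : pmetricType R}.
Variable mu : {outer_measure set X -> \bar R}.
Hypothesis mu_borel : borel_regular mu.
Local Open Scope ereal_scope.

(** A Borel regular outer measure restricts to a measure on Borel sets, to which
    integration theory applies; the function itself is unchanged. *)
Lemma borel_measure_exists : exists m : {measure set (borel X) -> \bar R},
  (m : set (borel X) -> \bar R) = mu.
Proof.
have sa : semi_sigma_additive (mu : set (borel X) -> \bar R).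
  move=> F mF tF _; apply: (@caratheodory_measure_sigma_additive _ _ mu) => //.
  - by move=> n; apply: mu_borel.1; exact: mF.
  - apply: (@bigcup_measurable _ (caratheodory_type mu)) => n _.
    by apply: mu_borel.1; exact: mF.
have mu0 : (mu : set (borel X) -> \bar R) set0 = 0 by exact: outer_measure0.
have mug0 : forall A, 0 <= (mu : set (borel X) -> \bar R) A.
  by move=> A; exact: outer_measure_ge0.
pose m : {measure set (borel X) -> \bar R} :=
  HB.pack (mu : set (borel X) -> \bar R)
    (isMeasure.Build _ (borel X) R (mu : set (borel X) -> \bar R) mu0 mug0 sa).
by exists m.
Qed.

Lemma open_borel_measurable (A : set X) : open A -> measurable (A : set (borel X)).
Proof. exact: sub_sigma_algebra. Qed.

Lemma disjoint_open_sum_le (B : (set X)^nat) (V : set X) :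
  (forall n, open (B n)) -> trivIset setT B -> open V ->
  \sum_(n <oo) mu (B n `&` V) <= mu V.
Proof.
move=> Bo tB Vo; have [m mE] := borel_measure_exists.
have mB n : measurable (B n `&` V : set (borel X)).
  by apply: open_borel_measurable; exact: openI.
have tBV : trivIset setT (fun n => B n `&` V).
  exact: trivIset_setIr.
rewrite -mE -measure_semi_bigcup//; last exact: bigcup_measurable.
apply: le_measure; rewrite ?inE; first exact: bigcup_measurable.
  exact: open_borel_measurable.
by apply: bigcup_sub => n _; exact: subIsetr.
Qed.

(** Grouping disjoint sets [B n] according to an index [k n] such that [B n]
    lies in [V (k n)]: the [B n] with the same index have total measure at most
    that of the corresponding [V]. *)
Lemma disjoint_weighted_sum_le (B V : (set X)^nat) (k : nat -> nat)
    (c : nat -> R) : (forall n, open (B n)) -> trivIset setT B ->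
  (forall n, open (V n)) -> (forall n, B n `<=` V (k n)) -> (forall n, 0 <= c n)%R ->
  \sum_(n <oo) (c (k n))%:E * mu (B n) <= \sum_(j <oo) (c j)%:E * mu (V j).
Proof.
move=> Bo tB Vo BV c0.
have t0 n j : 0 <= (c j)%:E * mu (B n `&` V j).
  by rewrite mule_ge0 ?lee_fin// outer_measure_ge0.
apply: (@le_trans _ _ (\sum_(n <oo) \sum_(j <oo) (c j)%:E * mu (B n `&` V j))).
  apply: lee_nneseries => [n _ _|n _].
    by rewrite mule_ge0 ?lee_fin// outer_measure_ge0.
  rewrite (nneseriesD1 (n := k n))//.
  rewrite (setIidl (BV n)) leeDl//; exact: nneseries_ge0.
rewrite nneseries_interchange//; apply: lee_nneseries => [j _ _|j _].
  by exact: nneseries_ge0.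
rewrite nneseriesZl; last by move=> n _; exact: outer_measure_ge0.
by rewrite lee_wpmul2l ?lee_fin//; exact: disjoint_open_sum_le.
Qed.

Section ball_density.
Variables (Q : R) (B : (set X)^nat) (c : nat -> R).
Hypotheses (Q0 : (0 < Q)%R) (Bo : forall n, open (B n)) (c0 : forall n, (0 <= c n)%R).

(** The l^Q norm of the family of functions [c n] on [B n]: it dominates each of
    them, and its Q-th power is additive in the family. *)
Definition lQ_density (x : X) : \bar R :=
  poweR (\sum_(n <oo) (c n `^ Q * \1_(B n) x)%:E) Q^-1.

Let term_ge0 n x : 0 <= (c n `^ Q * \1_(B n) x)%:E.
Proof. by rewrite lee_fin mulr_ge0// ?powR_ge0// indicE. Qed.

Let measurable_term n : measurable_fun [set: borel X]
  (fun x : borel X => (c n `^ Q * \1_(B n) x)%:E).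
Proof.
apply/measurable_EFinP; apply: measurable_funM => //.
by apply: measurable_indic; exact: open_borel_measurable.
Qed.

Lemma lQ_density_ge0 x : 0 <= lQ_density x. Proof. exact: poweR_ge0. Qed.

Lemma measurable_lQ_density : measurable_fun [set: borel X] lQ_density.
Proof.
apply: (measurableT_comp (measurable_poweR _)).
exact: ge0_emeasurable_sum.
Qed.

Lemma lQ_density_ge n x : B n x -> (c n)%:E <= lQ_density x.
Proof.
move=> Bx; have -> : (c n)%:E = poweR (c n `^ Q)%:E Q^-1.
  by rewrite poweR_EFin -powRrM mulfV ?gt_eqF// powRr1.
apply: gt0_ler_poweR; rewrite ?invr_ge0 ?(ltW Q0)//.
- by rewrite in_itv /= leey lee_fin powR_ge0.
- by rewrite in_itv /= leey andbT nneseries_ge0.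
rewrite (nneseriesD1 (n := n))// indicE mem_set// mulr1 leeDl//.
exact: nneseries_ge0.
Qed.

Lemma integral_lQ_density :
  \int[(mu : set (borel X) -> \bar R)]_(x in [set: borel X])
    poweR (lQ_density x) Q = \sum_(n <oo) (c n `^ Q)%:E * mu (B n).
Proof.
have [m mE] := borel_measure_exists; rewrite -mE.
have -> : (fun x : borel X => poweR (lQ_density x) Q) =
    (fun x => \sum_(n <oo) (c n `^ Q * \1_(B n) x)%:E).
  apply/funext => x; rewrite /lQ_density -poweRrM mulVf ?gt_eqF// poweRe1//.
  exact: nneseries_ge0.
rewrite integral_nneseries//; apply: eq_eseriesr => n _.
under eq_integral do rewrite EFinM.
rewrite ge0_integralZl_EFin//; last 2 first.
- apply/measurable_EFinP; apply: measurable_indic; exact: open_borel_measurable.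
- exact: powR_ge0.
by rewrite integral_indic// ?setIT//; exact: open_borel_measurable.
Qed.

End ball_density.

Lemma modulus_lQ_density (Q : R) (B : (set X)^nat) (c : nat -> R)
    (Gamma : set (R -> X)) : (0 < Q)%R -> (forall n, open (B n)) ->
  (forall n, 0 <= c n)%R ->
  (forall gamma, Gamma gamma -> locally_rectifiable gamma ->
    1 <= line_integral (lQ_density Q B c) gamma) ->
  modulus mu Q Gamma <= \sum_(n <oo) (c n `^ Q)%:E * mu (B n).
Proof.
move=> Q0 Bo c0 H; rewrite -integral_lQ_density//.
apply: ereal_inf_lbound; exists (lQ_density Q B c) => //.
split => //; first exact: measurable_lQ_density.
exact: lQ_density_ge0.
Qed.

End borel_measure.

(** * Mass of small balls *)

Section metric_preliminaries.
Context {R : realType} {X : metricType R}.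

Lemma open_mball (x : X) (r : R) : open (ball x r).
Proof.
rewrite openE => y; rewrite ballEmdist /= => xy.
apply/nbhs_ballP; exists (r - mdist x y); first by rewrite /= subr_gt0.
move=> z; rewrite !ballEmdist /= => yz.
by apply: le_lt_trans (metric_triangle x y z) _; rewrite -ltrBrDl.
Qed.

Lemma mdist_triangle_norm (x y z : X) : `|mdist x y - mdist x z| <= mdist y z.
Proof.
rewrite ler_norml; have := metric_triangle x y z; have := metric_triangle x z y.
by rewrite (metric_sym z y) => *; lra.
Qed.

Lemma pointwise_lipschitz_continuous (u : X -> R) :
  (forall x, exists k, forall x', `|u x - u x'| <= k * mdist x x') ->
  continuous u.
Proof.
move=> H x; apply/cvgrPdist_lt => e e0; have [k Hk] := H x.
have k0 : 0 < `|k| + 1 by rewrite ltr_wpDl.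
apply/nbhs_ballP; exists (e / (`|k| + 1)); first by rewrite /= divr_gt0.
move=> y; rewrite ballEmdist /= ltr_pdivlMr// => xy.
apply: le_lt_trans xy; apply: le_trans (Hk y) _.
rewrite mulrC ler_wpM2l ?mdist_ge0// (le_trans (ler_norm k))// lerDl//.
Qed.

(** The continuum is the part of a path from [p] to [q] before it first reaches
    distance [d] from [p]. *)
Lemma path_continuum (p q : X) (d : R) : @pathwise_connected R X ->
  0 <= d <= mdist p q -> exists E : set X, [/\ continuum E, E p,
    forall z, E z -> mdist p z <= d & exists2 z, E z & mdist p z = d].
Proof.
move=> /(_ p q) [gamma [gc g0 g1]] /andP[d0 dpq].
pose D (t : R) := mdist p (gamma t).
pose S := [set t : R | 0 <= t <= 1 /\ d <= D t].
have S1 : S 1 by split; rewrite ?lexx ?ler01// /D g1.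
have infS : has_inf S by split; [exists 1 | exists 0 => t [/andP[]]].
pose t1 := inf S.
have t10 : 0 <= t1 by apply: lb_le_inf; [exists 1 | move=> t [/andP[]]].
have t11 : t1 <= 1 by apply: ge_inf => //; case: infS.
have t101 : 0 <= t1 <= 1 by rewrite t10.
have Dt s : 0 <= s -> s < t1 -> D s < d.
  move=> s0 st; rewrite ltNge; apply/negP => dD.
  suff : t1 <= s by rewrite leNgt st.
  apply: ge_inf; first by case: infS.
  by split => //; rewrite s0 (le_trans (ltW st)).
have Dt1 : D t1 = d.
  apply/eqP; rewrite eq_le; apply/andP; split.
    have [->|t1n0] := eqVneq t1 0; first by rewrite /D g0 mdistxx.
    have {}t10 : 0 < t1 by rewrite lt_neqAle eq_sym t1n0.
    apply/ler_addgt0Pl => e e0; have [eta eta0 He] := is_curve_dist gc t101 e0.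
    pose s := Num.max 0 (t1 - eta / 2).
    have s0 : 0 <= s by rewrite le_max lexx.
    have st : s < t1 by rewrite gt_max t10 gtrBl divr_gt0.
    have ts : t1 - eta / 2 <= s by rewrite le_max lexx orbT.
    have : mdist (gamma t1) (gamma s) < e.
      apply: He; first by rewrite s0 (le_trans (ltW st) t11).
      by rewrite gtr0_norm ?subr_gt0//; lra.
    have := Dt s s0 st; have := metric_triangle p (gamma s) (gamma t1).
    by rewrite (metric_sym (gamma s)) -/(D s) -/(D t1) => *; lra.
  apply/ler_addgt0Pl => e e0; have [eta eta0 He] := is_curve_dist gc t101 e0.
  have [s [s01 ds] st] := inf_adherent eta0 infS; rewrite -/t1 in st.
  have ts : t1 <= s by apply: ge_inf; [case: infS | split].
  have : mdist (gamma t1) (gamma s) < e.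
    by apply: He => //; rewrite ler0_norm ?subr_le0// opprB; lra.
  have := metric_triangle p (gamma t1) (gamma s).
  by rewrite -/(D s) -/(D t1) => *; lra.
have cg : {within `[0, t1], continuous gamma}.
  apply: continuous_subspaceW gc => s /=; rewrite !in_itv /= => /andP[-> st].
  exact: le_trans t11.
exists (gamma @` `[0, t1]); split.
- split; first by apply: continuous_compact => //; exact: segment_compact.
  by apply: connected_continuous_connected => //; exact: segment_connected.
- by exists 0 => //; rewrite /= in_itv /= lexx.
- move=> _ [s + <-]; rewrite /= in_itv /= => /andP[s0].
  rewrite le_eqVlt => /predU1P[->|st]; first by rewrite -/(D t1) Dt1.
  by rewrite ltW// Dt.
- by exists (gamma t1) => //; exists t1 => //; rewrite /= in_itv /= t10 lexx.
Qed.

Lemma set_dist_le (E F : set X) x y : E x -> F y ->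
  (set_dist E F <= (mdist x y)%:E)%E.
Proof. by move=> Ex Fy; apply: ereal_inf_lbound; exists (x, y). Qed.

Lemma set_diam_ge (E : set X) x y : E x -> E y ->
  ((mdist x y)%:E <= set_diam E)%E.
Proof. by move=> Ex Fy; apply: ereal_sup_ubound; exists (x, y). Qed.

End metric_preliminaries.

Section mass_bounds.
Context {R : realType} {X : pmetricType R}.

Lemma relatively_closeI (E F : set X) (t d l : R) x y e e' g g' : 0 < t ->
  0 < d -> (forall x y, E x -> F y -> d <= mdist x y) ->
  E x -> F y -> mdist x y <= t * l ->
  E e -> E e' -> l <= mdist e e' -> F g -> F g' -> l <= mdist g g' ->
  relatively_close t E F.
Proof.
move=> t0 d0 H Ex Fy xy Ee Ee' le Fg Fg' lg; split.
  apply: (@lt_le_trans _ _ d%:E); first by rewrite lte_fin.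
  by apply: le_ereal_inf_tmp => _ [[a b] [Ea Fb] <-]; rewrite lee_fin; exact: H.
apply: le_trans (set_dist_le Ex Fy) _.
apply: (@le_trans _ _ (t%:E * l%:E)%E); first by rewrite -EFinM lee_fin.
apply: lee_wpmul2l; first by rewrite lee_fin ltW.
rewrite le_min; apply/andP; split.
  by apply: le_trans (set_diam_ge Ee Ee'); rewrite lee_fin.
by apply: le_trans (set_diam_ge Fg Fg'); rewrite lee_fin.
Qed.

Variables (mu : {outer_measure set X -> \bar R}) (Q : R).
Hypotheses (Q0 : 0 < Q) (mu_borel : borel_regular mu).

(** Curves from B(x, r/8) to the outside of B(x, 3r/8) have length at least r/4
    inside B(x, r), so a multiple of the indicator of that ball is admissible. *)
Lemma modulus_ring_le (x : X) (r : R) (E F : set X) : 0 < r ->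
  (forall z, E z -> mdist x z <= r / 8) ->
  (forall z, F z -> 3 * r / 8 <= mdist x z) ->
  (modulus mu Q (connecting_curves E F) <=
    ((8 / r) `^ Q)%:E * mu (ball x r))%E.
Proof.
move=> r0 HE HF; have c0 : 0 < 8 / r by rewrite divr_gt0.
pose B (n : nat) := if n == 0%N then ball x r else set0.
have Bo n : open (B n) by rewrite /B; case: ifP => _; [exact: open_mball | exact: open0].
pose c (n : nat) := 8 / r.
have -> : (((8 / r) `^ Q)%:E * mu (ball x r) =
    \sum_(n <oo) (c n `^ Q)%:E * mu (B n))%E.
  rewrite (nneseriesD1 (n := 0%N))//; last first.
    by move=> n _; rewrite mule_ge0 ?lee_fin ?powR_ge0// outer_measure_ge0.
  rewrite eseries0 ?adde0// => n _ /= n0.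
  by rewrite /B (negbTE n0) outer_measure0 mule0.
apply: modulus_lQ_density => //; first by move=> n; exact: ltW.
move=> gamma [gc Eg Fg] gr.
pose u y := 8 / r * Num.min (mdist x y) (3 * r / 8).
have uL y y' : `|u y - u y'| <= 8 / r * mdist y y'.
  rewrite /u -mulrBr normrM gtr0_norm// ler_pM2l//.
  have := mdist_triangle_norm x y y'; rewrite !ler_norml.
  by case: (leP (mdist x y)); case: (leP (mdist x y')) => *; lra.
have uc : continuous u.
  by apply: pointwise_lipschitz_continuous => y; exists (8 / r) => y'.
have xg0 := HE _ Eg; have xg1 := HF _ Fg.
have g01 : r / 8 <= mdist (gamma 0) (gamma 1).
  by have := metric_triangle x (gamma 0) (gamma 1); lra.
have mrho : measurable_fun [set: borel X] (lQ_density Q B c).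
  exact: measurable_lQ_density.
have rho0 y : (0 <= lQ_density Q B c y)%E by exact: lQ_density_ge0.
have := line_integral_oscillation gc gr mrho rho0 uc.
have -> : u (gamma 1) = 3.
  by rewrite /u (min_idPr _)//; field; rewrite gt_eqF.
have u0 : u (gamma 0) <= 1.
  rewrite /u (min_idPl _); last by lra.
  by rewrite mulrAC ler_pdivrMr// mul1r; lra.
move=> H; have H1 : (2%:E <= 2%:E * line_integral (lQ_density Q B c) gamma)%E.
  apply: le_trans (H _).
    by rewrite lee_fin (le_trans _ (ler_norm _))//; lra.
  move=> y; have [xy|xy] := ltP (mdist x y) (7 * r / 8).
    exists (r / 8), (8 / r); split => //; [by lra|by rewrite ltW|].
    move=> y' yy'; split.
      apply: (@lQ_density_ge _ _ _ _ _ Q0 (fun n => ltW c0) 0%N).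
      rewrite /B eqxx ballEmdist /=.
      by have := metric_triangle x y y'; lra.
    rewrite distrC (le_trans (uL _ _))// ler_wpM2l// ltW//.
  exists (r / 8), 0; split => //; first by lra.
  move=> y' yy'; split; first exact: lQ_density_ge0.
  rewrite mul0r /u !(min_idPr _) ?subrr ?normr0//; first by lra.
  by have := metric_triangle x y' y; rewrite (metric_sym y'); lra.
by move: H1; rewrite -[leLHS]mule1 lee_pmul2l.
Qed.

(** The upper bound is part of bounded geometry.  For the lower one, take in
    B(x, r) two continua of diameter at least r/8, at distance between r/4 and
    r/2: the modulus of the curves joining them is at least [phi 4], and at most
    [(8 / r)^Q] times the mass of B(x, r). *)
Lemma ball_mass_bounds : locally_bounded_geometry mu Q ->
  (forall x : X, exists y, x != y) ->
  exists c C : R, [/\ 0 < c, 0 < C & forall x : X, exists2 r0, 0 < r0 &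
    forall r, 0 < r -> r <= r0 ->
      ((c * r `^ Q)%:E <= mu (ball x r) <= (C * r `^ Q)%:E)%E].
Proof.
move=> [_ pc _ [C [phi [C1 phi0 _ H]]]] Xn.
have P0 : 0 < (8 `^ Q : R) by exact: powR_gt0.
exists (phi 4 / 8 `^ Q), C; split.
- by rewrite divr_gt0// phi0.
- exact: lt_le_trans C1.
move=> x; have [U [Ux _ H1 H2]] := H x; have [y xy] := Xn x.
have /nbhs_ballP[r1 /= r10 r1U] := Ux.
have xy0 : 0 < mdist x y by rewrite mdist_gt0.
exists (Num.min r1 (mdist x y)); first by rewrite lt_min r10.
move=> r r0; rewrite le_min => /andP[rr1 rxy].
have BU : ball x r `<=` U.
  by apply: subset_trans r1U; exact: le_ball.
apply/andP; split; last exact: H1.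
have [E [cE Ex HE [e Ee xe]]] : exists E : set X, [/\ continuum E, E x,
    forall z, E z -> mdist x z <= r / 8 & exists2 z, E z & mdist x z = r / 8].
  by apply: (@path_continuum _ _ x y) => //; lra.
have [_ [_ _ _ [p _ xp]]] : exists E : set X, [/\ continuum E, E x,
    forall z, E z -> mdist x z <= r / 2 & exists2 z, E z & mdist x z = r / 2].
  by apply: (@path_continuum _ _ x y) => //; lra.
have [F [cF Fp HF [g Fg pg]]] : exists E : set X, [/\ continuum E, E p,
    forall z, E z -> mdist p z <= r / 8 & exists2 z, E z & mdist p z = r / 8].
  by apply: (@path_continuum _ _ p x) => //; rewrite metric_sym; lra.
have HF' z : F z -> 3 * r / 8 <= mdist x z /\ mdist x z < r.
  move=> Fz; have := HF _ Fz; have := metric_triangle x z p.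
  by have := metric_triangle x p z; rewrite (metric_sym z p); lra.
have := H2 x r E F 4 r0 BU cE cF.
have EB : E `<=` ball x r.
  by move=> z /HE; rewrite ballEmdist /=; lra.
have FB : F `<=` ball x r.
  by move=> z /HF'; rewrite ballEmdist /=; lra.
have t4 : 0 < (4 : R) by [].
move=> /(_ EB FB t4) H3.
have {}H3 : ((phi 4)%:E <= modulus mu Q (connecting_curves E F))%E.
  apply: H3; apply: (@relatively_closeI E F 4 (r / 4) (r / 8) x p x e p g) => //.
  - by lra.
  - move=> a b /HE xa /HF'[xb _]; have := metric_triangle x a b; lra.
  - by lra.
  - by lra.
  - by lra.
have := le_trans H3 (modulus_ring_le r0 HE (fun z Fz => (HF' z Fz).1)).
have r8 : 0 < (8 / r) `^ Q by rewrite powR_gt0// divr_gt0.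
rewrite -lee_pdivrMl// => H4.
rewrite (le_trans _ H4)// -EFinM lee_fin powRM ?invr_ge0 ?(ltW r0)//.
have rQ : r^-1 `^ Q = (r `^ Q)^-1.
  by rewrite -powR_inv1 ?(ltW r0)// -powRrM mulN1r powRN.
by rewrite rQ invfM invrK le_eqVlt; apply/predU1P; left; ring.
Qed.

End mass_bounds.

(** * Vitali covering *)

Section covering.
Context {R : realType} {X : pmetricType R}.
Variable s : X -> R.
Hypotheses (s_gt0 : forall x, 0 < s x) (s_le1 : forall x, s x <= 1).

Let meets (x y : X) := ball x (s x) `&` ball y (s y) !=set0.

(** Vitali's covering argument.  Among the disjoint subfamilies whose members
    that meet a given ball include one at least half as large, a maximal one
    meets every ball: otherwise an almost largest avoided ball could be added. *)
Lemma vitali_cover : exists D : set X,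
  (forall a b, D a -> D b -> a <> b -> ~ meets a b) /\
  (forall x, exists2 a, D a & mdist a x < 3 * s a).
Proof.
pose disj (D : set X) := forall a b, D a -> D b -> a <> b -> ~ meets a b.
pose large (D : set X) := forall x a, D a -> meets x a ->
  exists b, [/\ D b, meets x b & s x <= 2 * s b].
have [|D [[dD lD] maxD]] := @Zorn_bigcup X [set D | disj D /\ large D].
  move=> F FP Ftot; split.
    move=> a b [A FA Aa] [B FB Bb] ab.
    have [AB|BA] := Ftot _ _ FA FB.
      by apply: (FP _ FB).1 => //; exact: AB.
    by apply: (FP _ FA).1 => //; exact: BA.
  move=> x a [A FA Aa] xa; have [b [Ab xb sxb]] := (FP _ FA).2 x a Aa xa.
  by exists b; split => //; exists A.
have meetD x : exists2 a, D a & meets x a.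
  apply: contrapT => nx.
  pose F := [set y | ~ exists2 a, D a & meets y a].
  have supF : has_sup (s @` F).
    split; first by exists (s x); exists x.
    by exists 1 => _ [y _ <-].
  have Sx : s x <= sup (s @` F) by apply: ub_le_sup; [case: supF | exists x].
  have S0 : 0 < sup (s @` F) by exact: lt_le_trans Sx.
  have [|_ [y Fy <-] Sy] := @sup_adherent _ (s @` F) (sup (s @` F) / 2) _ supF.
    by rewrite divr_gt0.
  have yy : meets y y by exists y; split; apply: ballxx.
  apply: (maxD (D `|` [set y])).
    split; first by move=> a Da; left.
    by move=> /(_ y) H; apply: Fy; exists y => //; apply: H; right.
  split.
    move=> a b [Da|->] [Db|->] ab //; first exact: dD.
      by move=> ay; apply: Fy; exists a => //; case: ay => z [? ?]; exists z.
    by move=> yb; apply: Fy; exists b.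
  move=> z a Da za; have [[b Db zb]|nz] := pselect (exists2 b, D b & meets z b).
    by have [e [De ze sze]] := lD z b Db zb; exists e; split => //; left.
  case: Da => [Da|ay]; first by case: nz; exists a.
  exists y; split; [by right|by rewrite -ay|].
  have : s z <= sup (s @` F) by apply: ub_le_sup; [case: supF | exists z].
  by lra.
exists D; split => // x; have [a Da xa] := meetD x.
have [b [Db [z [xz bz]] sxb]] := lD x a Da xa.
move: xz bz; rewrite !ballEmdist /= => xz bz; exists b => //.
by have := metric_triangle b z x; rewrite (metric_sym z x); lra.
Qed.

Lemma vitali_cover_seq : separable X -> exists (z : nat -> X) (act : set nat),
  trivIset setT (fun n => if n \in act then ball (z n) (s (z n)) else set0) /\
  (forall x, exists2 n, act n & mdist (z n) x < 3 * s (z n)).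
Proof.
move=> [S cS dS]; have [D [dD cD]] := vitali_cover.
have /choice[p pP] x : exists p, ball x (s x) p /\ S p.
  have [|p [xp Sp]] := dS (ball x (s x)) _ (open_mball _ _); last by exists p.
  by exists x; exact: ballxx.
have /countable_injP[g ginj] := cS.
pose f x := g (p x).
have finj a b : D a -> D b -> f a = f b -> a = b.
  move=> Da Db /ginj; rewrite !inE => /(_ (pP a).2 (pP b).2) pab.
  apply: contrapT => ab; apply: (dD a b Da Db ab); exists (p a).
  by split; [exact: (pP a).1 | rewrite pab; exact: (pP b).1].
pose act := [set n | exists2 a, D a & f a = n].
pose z n := xget point [set a | D a /\ f a = n].
have zP n : act n -> D (z n) /\ f (z n) = n.
  move=> [a Da fa]; suff : [set a | D a /\ f a = n] (z n) by [].
  by apply: xgetPex; exists a.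
exists z, act; split.
  apply/trivIsetP => i j _ _ ij; apply/seteqP; split => // x [].
  case: ifPn => // /set_mem /zP[Di fi]; case: ifPn => // /set_mem /zP[Dj fj] xi xj.
  apply: (dD _ _ Di Dj); last by exists x.
  by move=> zij; move: ij; rewrite -fi -fj zij eqxx.
move=> x; have [a Da xa] := cD x; exists (f a); first by exists a.
have actfa : act (f a) by exists a.
by have [Dz fz] := zP _ actfa; rewrite (finj _ _ Dz Da fz).
Qed.

End covering.

(** * Infinitesimal shape of preimages of balls *)

Section infinitesimal_shape.
Context {R : realType} {X Y : metricType R}.
Variable f : X -> Y.

(** Apply the bound on the distortion with [r] the distance from [x] to [x1].  The
    infimum in the denominator is positive by continuity of the inverse, so the
    bound on the quotient does compare the supremum with the infimum. *)
Lemma quasiconformal_weak_quasisymmetry : quasiconformal f ->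
  exists2 K, 1 <= K & forall x, exists2 r0, 0 < r0 & forall x1 x2,
    mdist x x1 < r0 -> mdist x x2 <= mdist x x1 ->
    mdist (f x) (f x2) <= K * mdist (f x) (f x1).
Proof.
move=> [[fc [g [fg gf gc]]] [K [K1 HK]]]; exists (K + 1); first by lra.
move=> x; have : (limf_esup (distortion f x) 0^'+ < (K + 1)%:E)%E.
  by apply: le_lt_trans (HK x) _; rewrite lte_fin; lra.
rewrite limf_esupE => /ereal_inf_lt[_ [V V0 <-] HV].
have /nbhs_ballP[r0 /= r00 Hr0] : nbhs (0 : R) (fun r => 0 < r -> V r) by exact: V0.
exists r0 => // x1 x2 x1r x21.
have [r0x|rpos] := leP (mdist x x1) 0.
  have xx1 : mdist x x1 = 0 by apply/eqP; rewrite eq_le r0x mdist_ge0.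
  rewrite xx1 in x21.
  have -> : x2 = x by apply/esym/mdist_positivity/eqP; rewrite eq_le x21 mdist_ge0.
  by rewrite mdistxx mulr_ge0 ?mdist_ge0//; lra.
set r := mdist x x1 in x1r x21 rpos.
have Vr : V r by apply: Hr0 => //; rewrite /ball /= sub0r normrN gtr0_norm.
have : (distortion f x r <= (K + 1)%:E)%E.
  by apply: le_trans (ltW HV); apply: ereal_sup_ubound; exists r.
rewrite /distortion; set S := ereal_sup _; set I := ereal_inf _.
have S2 : ((mdist (f x) (f x2))%:E <= S)%E by apply: ereal_sup_ubound; exists x2.
have I1 : (I <= (mdist (f x) (f x1))%:E)%E.
  by apply: ereal_inf_lbound; exists x1 => //=.
have [d d0 Hd] : exists2 d, 0 < d & forall x', r <= mdist x x' -> d <= mdist (f x) (f x').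
  have /metricType_numDomainType.cvgrPdist_lt/(_ _ rpos)/nbhs_ballP[d /= d0 Hd] := gc (f x).
  exists d => // x' rx'; rewrite leNgt; apply/negP => dx'.
  have := Hd (f x'); rewrite ballEmdist /= !fg => /(_ dx').
  by rewrite ltNge rx'.
have I0 : (d%:E <= I)%E.
  by apply: le_ereal_inf_tmp => _ [x' /= rx' <-]; rewrite lee_fin; exact: Hd.
have Ifin : I \is a fin_num.
  by rewrite fin_numElt (lt_le_trans _ I0) ?ltNyr// (le_lt_trans I1) ?ltry.
rewrite -(fineK Ifin) in I0 I1 *; rewrite !lee_fin in I0 I1.
have i0 : 0 < fine I by exact: lt_le_trans I0.
rewrite inver gt_eqF// lee_pdivrMr// -EFinM => S1.
have := le_trans S2 S1; rewrite lee_fin => /le_trans; apply.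
by rewrite ler_wpM2l//; lra.
Qed.

Variables (x : X) (K r0 : R).
Hypotheses (K1 : 1 <= K) (r00 : 0 < r0).
Hypothesis weak_qs : forall x1 x2,
  mdist x x1 < r0 -> mdist x x2 <= mdist x x1 ->
  mdist (f x) (f x2) <= K * mdist (f x) (f x1).
Hypothesis fc : {for x, continuous f}.
Hypothesis fopen : forall r, 0 < r -> exists2 t, 0 < t &
  forall x', mdist (f x) (f x') <= t -> mdist x x' < r.

Let a (t : R) := sup [set mdist x x' | x' in [set x' | mdist (f x) (f x') <= t]].

(** At arbitrarily small scales [s], the preimage of the ball of radius [6 s]
    about [f x] either has outer radius [A] comparable to the inner radius [I]
    of the preimage of the ball of radius [s], or is negligibly small.  By weak
    quasisymmetry the outer radius [a t] is a lower bound for the inner radius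
    at scale [2 K t]; so if the first alternative fails at all small scales,
    then [a (t / (12 K)) <= a t / (24 K)] for all small [t], which forces
    [a t / t] to tend to 0 along a sequence, and then the second one holds. *)
Lemma round_or_small_preimage (Rx e smax : R) : 0 < Rx -> 0 < e -> 0 < smax ->
  exists s A I : R, [/\ 0 < s <= smax, 0 < I <= Rx,
   forall x', mdist x x' < I -> mdist (f x) (f x') < s,
   forall x', mdist (f x) (f x') < 6 * s -> mdist x x' <= A &
   0 <= A /\ (A <= 24 * K * I \/ A <= e * s)].
Proof.
move=> Rx0 e0 smax0.
have K0 : 0 < K := lt_le_trans ltr01 K1.
have K1' := K1.
pose r1 := Num.min r0 Rx.
have r10 : 0 < r1 by rewrite lt_min r00.
have [t0 t00 Ht0] := fopen r10.
have axx t : 0 <= t -> [set mdist x x' | x' in [set x' | mdist (f x) (f x') <= t]] 0.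
  by move=> t_ge0; exists x; rewrite ?mdistxx//= mdistxx.
have asup t : 0 <= t -> t <= t0 ->
    has_sup [set mdist x x' | x' in [set x' | mdist (f x) (f x') <= t]].
  move=> t_ge0 tt0; split; first by exists 0; exact: axx.
  exists r1 => _ [x' /= xt <-]; apply/ltW/Ht0; exact: le_trans tt0.
have aub t x' : 0 <= t -> t <= t0 -> mdist (f x) (f x') <= t -> mdist x x' <= a t.
  move=> t_ge0 tt0 xt; apply: ub_le_sup; first by case: (asup t t_ge0 tt0).
  by exists x'.
have ar1 t : 0 <= t -> t <= t0 -> a t <= r1.
  move=> t_ge0 tt0; apply: ge_sup; first by exists 0; exact: axx.
  by move=> _ [x' /= xt <-]; apply/ltW/Ht0; exact: le_trans tt0.
have age0 t : 0 <= t -> t <= t0 -> 0 <= a t.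
  by move=> t_ge0 tt0; have := aub t x t_ge0 tt0; rewrite !mdistxx; exact.
pose s1 := Num.min smax (t0 / 6).
have s10 : 0 < s1 by rewrite lt_min smax0 divr_gt0.
have s1smax : s1 <= smax by rewrite ge_min lexx.
have s1t0 : 6 * s1 <= t0.
  by rewrite mulrC -ler_pdivlMr// ge_min lexx orbT.
have innerP s : 0 < s -> exists2 I, 0 < I <= Rx &
    forall x', mdist x x' < I -> mdist (f x) (f x') < s.
  move=> s0; have /metricType_numDomainType.cvgrPdist_lt/(_ _ s0) := fc.
  move=> /nbhs_ballP[d /= d0 Hd]; exists (Num.min d Rx).
    by rewrite lt_min d0 Rx0 ge_min lexx orbT.
  by move=> x'; rewrite lt_min => /andP[xd _]; apply: Hd; rewrite ballEmdist.
apply: contrapT => none.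
have small s : 0 < s -> s <= s1 -> e * s < a (6 * s).
  move=> s0 ss1; rewrite ltNge; apply/negP => ae; apply: none.
  have [I I0 HI] := innerP s s0.
  have s6 : 6 * s <= t0 by apply: le_trans s1t0; rewrite ler_pM2l.
  have s60 : 0 <= 6 * s by rewrite mulr_ge0// ltW.
  exists s, (a (6 * s)), I; split => //.
  - by rewrite s0 (le_trans ss1).
  - by move=> x' xs; apply: aub => //; exact: ltW.
  - by split; [exact: age0 | right].
have decay t : 0 < t -> t <= 6 * s1 -> a (t / (12 * K)) <= a t / (24 * K).
  move=> tpos ts1; rewrite ler_pdivlMr; last by rewrite mulr_gt0.
  rewrite leNgt; apply/negP => rnd; apply: none.
  pose s := t / 6; have ts : t = 6 * s by rewrite /s mulrCA mulfV// mulr1.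
  have s0 : 0 < s by rewrite /s divr_gt0.
  have ss1 : s <= s1 by rewrite /s ler_pdivrMr// mulrC.
  have tt0 : t <= t0 by exact: le_trans s1t0.
  pose u := t / (12 * K); rewrite -/u in rnd.
  have us : K * u = s / 2.
    by rewrite /u /s; field; rewrite gt_eqF.
  have u0 : 0 < u by rewrite divr_gt0// mulr_gt0.
  have ut0 : u <= t0.
    rewrite (le_trans _ tt0)// /u ler_pdivrMr ?mulr_gt0// ler_peMr ?ltW//; lra.
  have [ub ulb] := (ar1 u (ltW u0) ut0, age0 u (ltW u0) ut0).
  have au : 0 < a u.
    rewrite lt_neqAle ulb andbT; apply/negP => /eqP au0; move: rnd.
    by rewrite -au0 mul0r ltNge (age0 t (ltW tpos) tt0).
  exists s, (a t), (a u); split.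
  - by rewrite s0 (le_trans ss1).
  - by rewrite au (le_trans ub)// ge_min lexx orbT.
  - move=> x' xu.
    have xu0 : 0 < a u - mdist x x' by rewrite subr_gt0.
    have [_ [x1 /= x1u <-]] := sup_adherent xu0 (asup u (ltW u0) ut0).
    rewrite -/(a u) => xx1; have {}xx1 : mdist x x' < mdist x x1 by lra.
    have x1r : mdist x x1 < r0.
      apply: lt_le_trans (Ht0 _ (le_trans x1u ut0)) _.
      by rewrite ge_min lexx.
    have := weak_qs x1r (ltW xx1); have := ler_wpM2l (ltW K0) x1u.
    by rewrite us; lra.
  - by move=> x'; rewrite -ts => xs; apply: aub => //; exact: ltW.
  - by split; [exact: age0 (ltW tpos) tt0 | left; rewrite mulrC ltW].
pose t1 := 6 * s1; have t10 : 0 < t1 by rewrite mulr_gt0.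
have th1 : (12 * K)^-1 <= 1 by rewrite invf_le1 ?mulr_gt0//; lra.
have th0 : 0 < (12 * K)^-1 by rewrite invr_gt0 mulr_gt0.
have thn n : 0 < t1 * (12 * K)^-1 ^+ n <= t1.
  by rewrite mulr_gt0 ?exprn_gt0//= ger_pMr// exprn_ile1// ltW.
have iter n : a (t1 * (12 * K)^-1 ^+ n) <= a t1 * (24 * K)^-1 ^+ n.
  elim: n => [|n IH]; first by rewrite !expr0 !mulr1.
  have /andP[tn0 tn1] := thn n.
  rewrite !exprSr !mulrA; apply: le_trans (decay _ tn0 tn1) _.
  by rewrite ler_wpM2r// invr_ge0 mulr_ge0// ltW.
have bound n : n%:R < 6 * a t1 / (e * t1).
  have /andP[tn0 tn1] := thn n.
  have sn0 : 0 < t1 * (12 * K)^-1 ^+ n / 6 by rewrite divr_gt0.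
  have sn1 : t1 * (12 * K)^-1 ^+ n / 6 <= s1 by rewrite ler_pdivrMr// [leRHS]mulrC.
  have H6 (z : R) : 6 * (z / 6) = z by rewrite mulrCA mulfV// mulr1.
  have := small _ sn0 sn1; rewrite H6 => /lt_le_trans/(_ (iter n)).
  have -> : (24 * K)^-1 = 2^-1 * (12 * K)^-1 :> R.
    by field; rewrite gt_eqF.
  rewrite exprMn => H; have thn0 : 0 < (12 * K)^-1 ^+ n by rewrite exprn_gt0.
  have {}H : e * (t1 / 6) < a t1 * 2^-1 ^+ n.
    rewrite -(ltr_pM2r thn0).
    have <- : e * (t1 * (12 * K)^-1 ^+ n / 6) = e * (t1 / 6) * (12 * K)^-1 ^+ n.
      by ring.
    by rewrite -[ltRHS]mulrA.
  have n2 : n%:R < 2 ^+ n :> R by rewrite -natrX ltr_nat ltn_expl.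
  apply: lt_trans n2 _; rewrite ltr_pdivlMr ?mulr_gt0//.
  have p2 : 0 < 2 ^+ n :> R by rewrite exprn_gt0.
  move: H; rewrite exprVn ltr_pdivlMr// => H.
  lra.
by have := bound (Num.truncn (6 * a t1 / (e * t1))).+1; rewrite ltNge ltW// truncnS_gt.
Qed.

End infinitesimal_shape.

(** * The modulus inequality *)

Section quasiconformal_modulus.
Context {R : realType}.

(** A substitute for the bound by [W] of the integral of [h] against [mu], which
    only sees [h] through its values at centres of small disjoint sets. *)
Definition packing_bound {X : pmetricType R} (mu : {outer_measure set X -> \bar R})
    (h : X -> R) (W : R) :=
  exists2 t : X -> R, (forall x, 0 < t x) &
    forall (B : (set X)^nat) (z : nat -> X), (forall n, open (B n)) ->
      trivIset setT B -> (forall n, B n `<=` ball (z n) (t (z n))) ->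
      (\sum_(n <oo) (h (z n))%:E * mu (B n) <= W%:E)%E.

Context {X Y : pmetricType R}.
Variables (muX : {outer_measure set X -> \bar R})
  (muY : {outer_measure set Y -> \bar R}) (Q : R).
Hypotheses (Q0 : 0 < Q) (muYb : borel_regular muY).
Variables (f : X -> Y) (g : Y -> X) (K : R).
Hypotheses (fc : continuous f) (gc : continuous g) (fg : cancel f g) (gf : cancel g f).
Hypothesis K1 : 1 <= K.
Hypothesis weak_qs : forall x, exists2 r0 : R, 0 < r0 & forall x1 x2,
  mdist x x1 < r0 -> mdist x x2 <= mdist x x1 ->
  mdist (f x) (f x2) <= K * mdist (f x) (f x1).
Variables (cX cY CY : R).
Hypotheses (cX0 : 0 < cX) (cY0 : 0 < cY) (CY0 : 0 < CY).
Hypothesis massX : forall x, exists2 r0 : R, 0 < r0 & forall r : R, 0 < r -> r <= r0 ->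
  ((cX * r `^ Q)%:E <= muX (ball x r))%E.
Hypothesis massY : forall y, exists2 r0 : R, 0 < r0 & forall r : R, 0 < r -> r <= r0 ->
  ((cY * r `^ Q)%:E <= muY (ball y r) <= (CY * r `^ Q)%:E)%E.
Hypothesis sepY : separable Y.
Variables (v w : X -> R) (h : Y -> R) (WX WY : R).
Hypotheses (w0 : forall x, 0 < w x) (h0 : forall y, 0 < h y).
Hypothesis vw : forall x x', `|v x - v x'| <= w x * mdist x x'.
Hypothesis packX : packing_bound muX (fun x => w x `^ Q) WX.
Hypothesis packY : packing_bound muY h WY.

Let M1 := CY * 12 `^ Q * (24 * K) `^ Q / cX.
Let M2 := CY * 12 `^ Q / cY.

(** The curves of [Gamma] have a definite oscillation of [v \o g], where
    [g] is the inverse of [f].  On a ball B(y, 6 s) chosen by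
    [round_or_small_preimage] this function oscillates by at most [2 w A], so the
    density [2 w A / s] on these balls does the job; the two terms of the bound
    come from the two alternatives for [A]. *)
Lemma quasiconformal_modulus_le (d0 : R) (Gamma : set (R -> Y)) : 0 < d0 ->
  (forall gamma, Gamma gamma -> [/\ is_curve gamma,
     d0 <= mdist (gamma 0) (gamma 1) &
     1 <= `|v (g (gamma 1)) - v (g (gamma 0))| ]) ->
  (modulus muY Q Gamma <= (M1 * WX + M2 * WY)%:E)%E.
Proof.
move=> d00 HG; have [tX tX0 HtX] := packX; have [tY tY0 HtY] := packY.
have K0 : 0 < K := lt_le_trans ltr01 K1.
have [/choice[rX rXP] /choice[rY rYP]] : (forall x, exists r0 : R, 0 < r0 /\
    forall r : R, 0 < r -> r <= r0 -> ((cX * r `^ Q)%:E <= muX (ball x r))%E) /\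
  (forall y, exists r0 : R, 0 < r0 /\ forall r : R, 0 < r -> r <= r0 ->
    ((cY * r `^ Q)%:E <= muY (ball y r) <= (CY * r `^ Q)%:E)%E).
  by split => z; [have [r0 ? ?] := massX z | have [r0 ? ?] := massY z]; exists r0.
(* [eta] is such that [A <= eta y * s] gives [(w A)^Q <= h y * s^Q]. *)
pose eta y := h y `^ Q^-1 / w (g y).
have eta0 y : 0 < eta y by rewrite divr_gt0// powR_gt0.
pose smax y := Num.min (Num.min 1 (d0 / 3)) (Num.min (rY y / 6) (tY y)).
have smax0 y : 0 < smax y.
  by rewrite !lt_min ltr01 tY0 !divr_gt0//; case: (rYP y).
pose Rx y := Num.min (rX (g y)) (tX (g y)).
have Rx0 y : 0 < Rx y by rewrite lt_min tX0 andbT; case: (rXP (g y)).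
have /choice[s sP] y : exists s : R, exists A I : R,
  [/\ 0 < s <= smax y, 0 < I <= Rx y,
   forall x', mdist (g y) x' < I -> mdist y (f x') < s,
   forall x', mdist y (f x') < 6 * s -> mdist (g y) x' <= A &
   0 <= A /\ (A <= 24 * K * I \/ A <= eta y * s)].
  have [r0 r00 Hr0] := weak_qs (g y).
  have fopen r : 0 < r -> exists2 t, 0 < t &
      forall x', mdist (f (g y)) (f x') <= t -> mdist (g y) x' < r.
    move=> rpos.
    have /metricType_numDomainType.cvgrPdist_lt/(_ _ rpos) := @gc (f (g y)).
    move=> /nbhs_ballP[d /= dpos Hd]; exists (d / 2); first by rewrite divr_gt0.
    move=> x' xd; rewrite -(fg x') -{1}(fg (g y)); apply: Hd.
    by rewrite ballEmdist /=; apply: le_lt_trans xd _; lra.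
  have [s [A [I]]] := round_or_small_preimage K1 r00 Hr0 (@fc _) fopen (Rx0 y)
    (eta0 y) (smax0 y).
  by rewrite gf => H; exists s, A, I.
move: sP => /choice[A] /choice[I] sP.
have sgt0 y : 0 < s y by have [/andP[]] := sP y.
have smaxle y : [/\ s y <= 1, 3 * s y <= d0, 6 * s y <= rY y & s y <= tY y].
  have [/andP[_ +] _ _ _ _] := sP y.
  by rewrite !le_min -andbA => /and4P[? ? ? ?]; split => //; lra.
have sle1 y : s y <= 1 by have [] := smaxle y.
have [z [act [tB cov]]] := vitali_cover_seq sgt0 sle1 sepY.
pose B n := if n \in act then ball (z n) (6 * s (z n)) else set0.
pose BY n := if n \in act then ball (z n) (s (z n)) else set0.
pose BX n := if n \in act then ball (g (z n)) (I (z n)) else set0.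
pose c n := 2 * (w (g (z n)) * A (z n)) / s (z n).
have Age0 y : 0 <= A y by have [_ _ _ _ []] := sP y.
have c0 n : 0 <= c n.
  by rewrite divr_ge0 ?(ltW (sgt0 _))// mulr_ge0// mulr_ge0 ?(ltW (w0 _)).
have Bo n : open (B n).
  by rewrite /B; case: ifP => _; [exact: open_mball | exact: open0].
have sumX : (\sum_(n <oo) (w (g (z n)) `^ Q)%:E * muX (BX n) <= WX%:E)%E.
  apply: (HtX BX (g \o z)).
  - by move=> n; rewrite /BX; case: ifP => _; [exact: open_mball | exact: open0].
  - move/trivIsetP : tB => tB; apply/trivIsetP => i j _ _ ij.
    have := tB i j Logic.I Logic.I ij; rewrite /BX.
    case: (boolP (i \in act)) => _; last by rewrite !set0I.
    case: (boolP (j \in act)) => _; last by rewrite !setI0.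
    move=> BB; apply/seteqP; split => // x [].
    have [_ _ Hi _ _] := sP (z i); have [_ _ Hj _ _] := sP (z j).
    rewrite !ballEmdist /= => /Hi xi /Hj xj.
    suff : (set0 : set Y) (f x) by [].
    by rewrite -BB; split; rewrite ballEmdist.
  - move=> n; rewrite /BX; case: ifP => _; last exact: sub0set.
    apply: le_ball => /=.
    have [_ /andP[_ +] _ _ _] := sP (z n).
    by rewrite le_min => /andP[].
have sumY : (\sum_(n <oo) (h (z n))%:E * muY (BY n) <= WY%:E)%E.
  apply: HtY => //.
  - by move=> n; rewrite /BY; case: ifP => _; [exact: open_mball | exact: open0].
  - move=> n; rewrite /BY; case: ifP => _; last exact: sub0set.
    apply: le_ball.
    by have [] := smaxle (z n).
have tX_ge0 n : (0 <= (w (g (z n)) `^ Q)%:E * muX (BX n))%E.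
  by rewrite mule_ge0 ?lee_fin ?powR_ge0// outer_measure_ge0.
have tY_ge0 n : (0 <= (h (z n))%:E * muY (BY n))%E.
  by rewrite mule_ge0 ?lee_fin ?(ltW (h0 _))// outer_measure_ge0.
have M10 : 0 <= M1.
  by rewrite /M1 divr_ge0 ?(ltW cX0)// !mulr_ge0 ?powR_ge0// ltW.
have M20 : 0 <= M2.
  by rewrite /M2 divr_ge0 ?(ltW cY0)// !mulr_ge0 ?powR_ge0// ltW.
apply: (@le_trans _ _ (\sum_(n <oo) (c n `^ Q)%:E * muY (B n))%E).
  apply: modulus_lQ_density => // gamma Gg gr.
  have [gac gad gav] := HG _ Gg.
  (* doubled to absorb the factor 2 of [line_integral_oscillation] *)
  pose u y := 2 * v (g y).
  have uc : continuous u.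
    move=> y; apply: (@continuous_comp _ _ _ g (fun x => 2 * v x)); first exact: gc.
    apply: pointwise_lipschitz_continuous => x; exists (2 * w x) => x'.
    by rewrite -mulrBr normrM gtr0_norm// -mulrA ler_pM2l.
  have mrho : measurable_fun [set: borel Y] (lQ_density Q B c).
    exact: measurable_lQ_density.
  have rho0 y : (0 <= lQ_density Q B c y)%E by exact: lQ_density_ge0.
  have := line_integral_oscillation gac gr mrho rho0 uc.
  move=> H; suff : (2%:E <= 2%:E * line_integral (lQ_density Q B c) gamma)%E.
    by rewrite -[X in (X <= _)%E -> _]mule1 lee_pmul2l.
  apply: le_trans (H _).
    by rewrite lee_fin /u -mulrBr normrM gtr0_norm//; lra.
  move=> y; have [n nact zy] := cov y.
  exists (3 * s (z n)), (c n); split => //.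
  - by rewrite mulr_gt0.
  - by have [_ + _ _] := smaxle (z n) => /le_trans; apply.
  move=> y' yy'.
  have zy' : mdist (z n) y' < 6 * s (z n).
    by have := metric_triangle (z n) y y'; lra.
  have zy6 : mdist (z n) y < 6 * s (z n) by have := sgt0 (z n); lra.
  split; first by apply: lQ_density_ge => //; rewrite /B mem_set// ballEmdist.
  have [_ _ _ HA _] := sP (z n).
  have Hv y1 : mdist (z n) y1 < 6 * s (z n) ->
      `|v (g (z n)) - v (g y1)| <= w (g (z n)) * A (z n).
    move=> zy1; apply: le_trans (vw _ _) _; rewrite ler_wpM2l ?(ltW (w0 _))//.
    by apply: HA; rewrite gf.
  have := Hv _ zy'; have := Hv _ zy6.
  rewrite /c /u -mulrBr normrM gtr0_norm// mulrCA divfK ?gt_eqF//.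
  have := ler_distD (v (g (z n))) (v (g y')) (v (g y)).
  rewrite (distrC (v (g y')) (v (g (z n)))).
  have := mulr_ge0 (ltW (w0 (g (z n)))) (Age0 (z n)).
  by lra.
apply: (@le_trans _ _ (\sum_(n <oo) (M1%:E * ((w (g (z n)) `^ Q)%:E * muX (BX n)) +
    M2%:E * ((h (z n))%:E * muY (BY n))))%E).
  apply: lee_nneseries => [n _ _|n _].
    by rewrite mule_ge0 ?lee_fin ?powR_ge0// outer_measure_ge0.
  have [nact|nact] := boolP (n \in act); last first.
    by rewrite /B /BX /BY (negbTE nact) !outer_measure0 !mule0 adde0.
  rewrite /B /BX /BY nact /=.
  have [/andP[_ _] /andP[I0 IR] _ _ [A0 AI]] := sP (z n).
  have [_ _ s6 _] := smaxle (z n); have sn0 := sgt0 (z n).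
  have sr : s (z n) <= rY (z n) by lra.
  have [_ HY] := rYP (z n); have [_ HX] := rXP (g (z n)).
  have s60 : 0 < 6 * s (z n) by rewrite mulr_gt0.
  have /andP[_ HB] := HY _ s60 s6.
  have /andP[HBY _] := HY _ sn0 sr.
  have /(HX _ I0) HBX : I (z n) <= rX (g (z n)).
    by move: IR; rewrite le_min => /andP[].
  apply: (@le_trans _ _ (CY * 12 `^ Q * (w (g (z n)) * A (z n)) `^ Q)%:E).
    apply: (@le_trans _ _ ((c n `^ Q)%:E * (CY * (6 * s (z n)) `^ Q)%:E)%E).
      by rewrite lee_wpmul2l// lee_fin powR_ge0.
    rewrite -EFinM lee_fin mulrCA -mulrA ler_wpM2l ?(ltW CY0)//.
    have wA0 := mulr_ge0 (ltW (w0 (g (z n)))) A0.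
    have cs : c n * (6 * s (z n)) = 12 * (w (g (z n)) * A (z n)).
      by rewrite /c; field; rewrite gt_eqF.
    rewrite -[leLHS]powRM; [|exact: c0|exact: ltW s60].
    by rewrite cs powRM.
  have wz := w0 (g (z n)).
  have PX : (0 <= M1%:E * ((w (g (z n)) `^ Q)%:E * muX (ball (g (z n)) (I (z n)))))%E.
    by rewrite !mule_ge0 ?lee_fin ?powR_ge0// outer_measure_ge0.
  have PY : (0 <= M2%:E * ((h (z n))%:E * muY (ball (z n) (s (z n)))))%E.
    by rewrite !mule_ge0 ?lee_fin ?(ltW (h0 _))// outer_measure_ge0.
  case: AI => [AI|As].
    apply: (@le_trans _ _ (M1%:E * ((w (g (z n)) `^ Q)%:E *
        muX (ball (g (z n)) (I (z n)))))%E); last by rewrite leeDl.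
    apply: (@le_trans _ _ (M1%:E * ((w (g (z n)) `^ Q)%:E *
        (cX * I (z n) `^ Q)%:E))%E); last first.
      by rewrite !lee_wpmul2l// lee_fin powR_ge0.
    rewrite -!EFinM lee_fin /M1.
    apply: (@le_trans _ _ (CY * 12 `^ Q * (w (g (z n)) * (24 * K * I (z n))) `^ Q)).
      rewrite ler_wpM2l ?mulr_ge0 ?powR_ge0 ?(ltW CY0)//.
      by rewrite ge0_ler_powR ?nnegrE ?(ltW Q0) ?mulr_ge0 ?(ltW wz) ?(ltW K0) ?(ltW I0)// ler_pM2l.
    rewrite !powRM ?mulr_ge0 ?(ltW wz) ?(ltW K0) ?(ltW I0)//.
    by rewrite le_eqVlt; apply/predU1P; left; field; rewrite gt_eqF.
  apply: (@le_trans _ _ (M2%:E * ((h (z n))%:E *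
      muY (ball (z n) (s (z n)))))%E); last by rewrite leeDr.
  apply: (@le_trans _ _ (M2%:E * ((h (z n))%:E * (cY * s (z n) `^ Q)%:E))%E); last first.
    by rewrite !lee_wpmul2l// lee_fin ltW.
  rewrite -!EFinM lee_fin /M2.
  apply: (@le_trans _ _ (CY * 12 `^ Q * (h (z n) * s (z n) `^ Q))).
    rewrite ler_wpM2l ?mulr_ge0 ?powR_ge0 ?(ltW CY0)//.
    have -> : h (z n) * s (z n) `^ Q = (h (z n) `^ Q^-1 * s (z n)) `^ Q.
      rewrite powRM ?powR_ge0 ?(ltW sn0)// -powRrM mulVf ?gt_eqF// powRr1//.
      exact: ltW.
    rewrite ge0_ler_powR ?nnegrE ?(ltW Q0) ?mulr_ge0 ?powR_ge0 ?(ltW wz) ?(ltW sn0)//.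
    rewrite mulrC -ler_pdivlMr//; apply: le_trans As _.
    by rewrite /eta mulrAC.
  by rewrite le_eqVlt; apply/predU1P; left; field; rewrite gt_eqF.
rewrite nneseriesD; last 2 first.
- by move=> n _ _; rewrite mule_ge0// lee_fin.
- by move=> n _ _; rewrite mule_ge0// lee_fin.
rewrite !nneseriesZl// EFinD !EFinM.
by apply: leeD; rewrite lee_wpmul2l// lee_fin.
Qed.

End quasiconformal_modulus.

(** * Packing bounds *)

Section packing.
Context {R : realType}.

Lemma geometric_nneseries_le (D q : R) : 0 <= D -> 0 <= q -> q < 1 ->
  (\sum_(k <oo) (D * q ^+ k)%:E <= (D / (1 - q))%:E)%E.
Proof.
move=> D0 q0 q1; have q10 : 0 < 1 - q by rewrite subr_gt0.
have t0 k : (0 <= (D * q ^+ k)%:E)%E by rewrite lee_fin mulr_ge0// exprn_ge0.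
apply: lime_le; first exact: is_cvg_nneseries.
apply: nearW => n; rewrite sumEFin lee_fin.
have -> : \sum_(0 <= k < n) D * q ^+ k = D * (1 - q ^+ n) / (1 - q).
  elim: n => [|n IH]; first by rewrite big_geq// expr0 subrr mulr0 mul0r.
  rewrite big_nat_recr//= IH exprSr; field; rewrite gt_eqF//.
rewrite ler_wpM2r ?invr_ge0 ?(ltW q10)// ler_piMr//.
by rewrite gerBl exprn_ge0.
Qed.

Context {X : pmetricType R}.
Variable mu : {outer_measure set X -> \bar R}.
Hypothesis mu_borel : borel_regular mu.

Lemma packing_bound_layers (h : X -> R) (k : X -> nat) (V : (set X)^nat)
    (c : nat -> R) (t D q : R) : 0 < t -> 0 <= D -> 0 <= q -> q < 1 ->
  (forall n, open (V n)) -> (forall n, 0 <= c n) ->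
  (forall x, 0 <= h x <= c (k x)) -> (forall x, ball x t `<=` V (k x)) ->
  (forall n, (c n)%:E * mu (V n) <= (D * q ^+ n)%:E)%E ->
  packing_bound mu h (D / (1 - q)).
Proof.
move=> t0 D0 q0 q1 Vo c0 hc BV cV; exists (fun=> t) => // B z Bo tB Bz.
apply: le_trans (geometric_nneseries_le D0 q0 q1).
apply: (@le_trans _ _ (\sum_(n <oo) (c n)%:E * mu (V n))%E); last first.
  by apply: lee_nneseries => // n _ _; rewrite mule_ge0 ?lee_fin// outer_measure_ge0.
have BVz n : B n `<=` V (k (z n)) by exact: subset_trans (Bz n) (BV _).
apply: le_trans (disjoint_weighted_sum_le mu_borel Bo tB Vo BVz c0).
have hz n : 0 <= h (z n) by case/andP: (hc (z n)).
apply: lee_nneseries => [n _ _|n _].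
  by rewrite mule_ge0 ?lee_fin// outer_measure_ge0.
by rewrite lee_wpmul2r ?outer_measure_ge0// lee_fin; case/andP: (hc (z n)).
Qed.

(** Dyadic layers [d(x0, x) ~ 2^k T]: since the mass grows slower than [r^Q],
    the sum of [(2^k T)^(-Q)] times the mass of the layers is a convergent
    geometric series. *)
Lemma packing_bound_growth (x0 : X) (Q N C0 T A : R) : 0 < Q -> N < Q ->
  0 <= C0 -> 0 < T -> 0 < A ->
  (forall r, T <= r -> (mu (ball x0 r) <= (C0 * r `^ N)%:E)%E) ->
  exists W, packing_bound mu (fun x => (A / Num.max (mdist x0 x) T) `^ Q) W.
Proof.
move=> Q0 NQ C00 T0 A0 growth.
have p2 n : 0 < 2 ^+ n :> R by rewrite exprn_gt0.
have /choice[k kP] x : exists k, mdist x0 x <= 2 ^+ k * T /\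
    2 ^+ k * T <= 2 * Num.max (mdist x0 x) T.
  have [xT|Tx] := leP (mdist x0 x) T.
    exists 0%N; rewrite expr0 mul1r; split => //.
    by rewrite ler_peMl ?(ltW T0)// ler1n.
  have ex : exists n, mdist x0 x <= 2 ^+ n * T.
    exists (Num.truncn (mdist x0 x / T)).+1; rewrite -ler_pdivrMr//.
    apply: le_trans (ltW (truncnS_gt _)) _.
    by rewrite -natrX ler_nat ltnW// ltn_expl.
  case: (ex_minnP ex) => -[|m].
    by rewrite expr0 mul1r leNgt Tx.
  move=> Hm Hmin; exists m.+1; split => //.
  rewrite exprS -mulrA ler_pM2l// ltW// ltNge; apply/negP => /Hmin.
  by rewrite ltnn.
pose c n := (2 * A / (2 ^+ n * T)) `^ Q.
pose D := (2 * A / T) `^ Q * C0 * (2 * T) `^ N.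
pose q : R := 2 `^ (N - Q).
have q1 : q < 1.
  rewrite lt_neqAle powR_eq1 (gt_eqF (ltr1n R 2)) ltrn0 /= subr_eq0 (lt_eqF NQ) /=.
  by rewrite -[leRHS](powRr0 2) ler_powR ?ler1n// subr_le0 ltW.
exists (D / (1 - q)).
apply: (@packing_bound_layers _ k (fun n => ball x0 (2 ^+ n.+1 * T)) c T) => //.
- by rewrite !mulr_ge0 ?powR_ge0.
- exact: powR_ge0.
- by move=> n; exact: open_mball.
- by move=> n; exact: powR_ge0.
- move=> x; rewrite powR_ge0 /=; have [_ kx] := kP x.
  have m0 : 0 < Num.max (mdist x0 x) T by rewrite lt_max T0 orbT.
  have kT0 : 0 < 2 ^+ k x * T by rewrite mulr_gt0.
  rewrite ge0_ler_powR ?nnegrE ?(ltW Q0) ?divr_ge0 ?mulr_ge0 ?(ltW A0) ?(ltW T0) ?(ltW m0)//.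
  rewrite ler_pdivrMr// mulrAC ler_pdivlMr//.
  apply: le_trans (ler_wpM2l (ltW A0) kx) _.
  by rewrite le_eqVlt; apply/predU1P; left; ring.
- move=> x y; have [kx _] := kP x; rewrite !ballEmdist /= exprS => xy.
  have := metric_triangle x0 x y.
  have : T <= 2 ^+ k x * T by rewrite ler_peMl ?(ltW T0)// exprn_ege1// ler1n.
  by rewrite -mulrA; lra.
move=> n; have e0 := p2 n.
have Tn : T <= 2 ^+ n.+1 * T by rewrite ler_peMl ?(ltW T0)// exprn_ege1// ler1n.
apply: (@le_trans _ _ ((c n)%:E * (C0 * (2 ^+ n.+1 * T) `^ N)%:E)%E).
  by rewrite lee_wpmul2l ?lee_fin ?powR_ge0//; exact: growth.
rewrite -EFinM lee_fin /c /D /q.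
have -> : 2 * A / (2 ^+ n * T) = (2 * A / T) * (2 ^+ n)^-1.
  by field; rewrite !gt_eqF.
have -> : 2 ^+ n.+1 * T = (2 * T) * 2 ^+ n by rewrite exprS; ring.
rewrite !powRM ?invr_ge0 ?(ltW e0) ?divr_ge0 ?mulr_ge0 ?(ltW A0) ?(ltW T0)//.
have -> : (2 `^ (N - Q)) ^+ n = (2 ^+ n)^-1 `^ Q * (2 ^+ n) `^ N :> R.
  rewrite -powR_mulrn ?powR_ge0// powRAC powR_mulrn// -powR_inv1 ?(ltW e0)//.
  by rewrite -powRrM -powRD ?(gt_eqF e0) ?implybT// mulN1r addrC.
by rewrite le_eqVlt; apply/predU1P; left; ring.
Qed.

(** Closed balls are compact, so local finiteness suffices. *)
Lemma proper_ball_finite_mass : proper_metric X ->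
  (forall x : X, exists2 r, 0 < r & (mu (ball x r) < +oo)%E) ->
  forall x r, (mu (ball x r) < +oo)%E.
Proof.
move=> pX fin x r.
have /choice[e eP] y : exists e, 0 < e /\ (mu (ball y e) < +oo)%E.
  by have [e e0 ?] := fin y; exists e.
have := pX x r; rewrite compact_cover.
move=> /(_ X setT (fun y => ball y (e y))) [].
- by move=> y _; exact: open_mball.
- by move=> y _; exists y => //; apply: ballxx; case: (eP y).
move=> F _; have /finite_seqP[s ->] := finite_fset F => cF.
have : (mu (\bigcup_(y in [set` s]) ball y (e y)) < +oo)%E.
  elim: s {cF} => [|y s IH].
    by rewrite (_ : [set` [::]] = set0) ?bigcup_set0 ?outer_measure0//; apply/seteqP; split.
  rewrite (_ : [set` (y :: s)] = y |` [set` s]); last first.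
    apply/seteqP; split => z /=; rewrite in_cons.
      by move=> /predU1P.
    by move=> /predU1P.
  rewrite bigcup_setU1; apply: le_lt_trans (outer_measureU2 _ _ _) _.
  by rewrite lte_add_pinfty//; case: (eP y).
apply: le_lt_trans; apply: le_outer_measure => y; rewrite ballEmdist /= => xy.
by apply: cF => /=; exact: ltW.
Qed.

(** The weight [h] prescribes how small the preimages of the second kind in
    [round_or_small_preimage] have to be at each point for their total
    contribution to be finite. *)
Lemma positive_packing : (forall x r, (mu (ball x r) < +oo)%E) ->
  exists h W, (forall x, 0 < h x) /\ packing_bound mu h W.
Proof.
move=> fin; pose x0 : X := point.
pose V n := ball x0 (n%:R + 2).
have Vfin n : mu (V n) = (fine (mu (V n)))%:E.
  by rewrite fineK// ge0_fin_numE ?outer_measure_ge0//; exact: fin.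
have Vge0 n : 0 <= fine (mu (V n)) by rewrite fine_ge0// outer_measure_ge0.
have V1 n : 0 < 1 + fine (mu (V n)) by rewrite ltr_pwDl.
pose c n := 2^-1 ^+ n / (1 + fine (mu (V n))).
have c0 n : 0 < c n by rewrite divr_gt0// exprn_gt0// invr_gt0.
pose k x := Num.truncn (mdist x0 x).
exists (fun x => c (k x)), (1 / (1 - 2^-1)); split => //.
apply: (@packing_bound_layers _ k V c 1) => //.
- by rewrite invf_lt1 ?ltr1n.
- by move=> n; exact: open_mball.
- by move=> n; exact: ltW.
- by move=> x; rewrite lexx ltW.
- move=> x y; rewrite /V !ballEmdist /= => xy.
  have := metric_triangle x0 x y; have := truncnS_gt (mdist x0 x).
  by rewrite -/(k x) -natr1; lra.
move=> n; rewrite Vfin -EFinM lee_fin mul1r /c mulrAC ler_pdivrMr//.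
by rewrite ler_wpM2l ?exprn_ge0 ?invr_ge0// lerDr.
Qed.

End packing.

(** * Separating the ends of a quasi-geodesic *)

Section metric_lemmas.
Context {R : realType}.

Lemma compact_mdist_bounded {X Y : metricType R} (g : Y -> X) (x0 : X) (E : set Y) :
  continuous g -> compact E -> exists M, forall y, E y -> mdist x0 (g y) <= M.
Proof.
move=> gc cE; have [[y0 Ey0]|E0] := pselect (E !=set0); last first.
  by exists 0 => y Ey; case: E0; exists y.
have uc : continuous (fun y => mdist x0 (g y)).
  move=> y; apply: (@continuous_comp _ _ _ g (mdist x0)); first exact: gc.
  apply: pointwise_lipschitz_continuous => x; exists 1 => x'.
  by rewrite mul1r mdist_triangle_norm.
have [|y _ Hy] := compact_EVT_max _ cE (continuous_subspaceT uc).
  by exists y0.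
by exists (mdist x0 (g y)) => z Ez; apply: Hy; rewrite inE.
Qed.

Lemma compact_separated {Y : metricType R} (E F : set Y) : compact E ->
  E !=set0 -> F !=set0 ->
  (forall x, E x -> exists2 d, 0 < d & forall y, F y -> d <= mdist x y) ->
  exists2 d, 0 < d & forall x y, E x -> F y -> d <= mdist x y.
Proof.
move=> cE E0 [y0 Fy0] sep.
pose D x := inf [set mdist x y | y in F].
have infD x : has_inf [set mdist x y | y in F].
  split; first by exists (mdist x y0); exists y0.
  by exists 0 => _ [y _ <-]; exact: mdist_ge0.
have Dle x y : F y -> D x <= mdist x y.
  by move=> Fy; apply: ge_inf; [case: (infD x) | exists y].
have D1 x x' : D x <= mdist x x' + D x'.
  rewrite -lerBlDl; apply: lb_le_inf; first by case: (infD x').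
  move=> _ [y Fy <-]; have := Dle x y Fy; have := metric_triangle x x' y; lra.
have Dc : continuous D.
  apply: pointwise_lipschitz_continuous => x; exists 1 => x'; rewrite mul1r.
  have := D1 x x'; have := D1 x' x; rewrite (metric_sym x' x) ler_norml => *; lra.
have [x Ex Hx] := compact_EVT_min E0 cE (continuous_subspaceT Dc).
rewrite inE in Ex; have [d d0 Hd] := sep x Ex.
exists (D x) => [|a b Ea Fb].
  apply: lt_le_trans d0 _; apply: lb_le_inf; first by case: (infD x).
  by move=> _ [y Fy <-]; exact: Hd.
by apply: le_trans (Dle a b Fb); apply: Hx; rewrite inE.
Qed.

Lemma ratio_lipschitz {X : metricType R} (p q : X -> R) (A : R) x x' :
  0 < q x -> 0 < q x' -> 0 <= p x' <= A * q x' ->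
  `|p x - p x'| <= mdist x x' -> `|q x - q x'| <= mdist x x' ->
  `|p x / q x - p x' / q x'| <= (1 + A) / q x * mdist x x'.
Proof.
move=> qx qx' /andP[p0 pA] pl ql.
have -> : p x / q x - p x' / q x' =
    ((p x - p x') + p x' / q x' * (q x' - q x)) / q x.
  by field; rewrite !gt_eqF.
rewrite normrM [`|(q x)^-1|]gtr0_norm ?invr_gt0// [leRHS]mulrAC.
rewrite ler_wpM2r ?invr_ge0 ?(ltW qx)//.
apply: le_trans (ler_normD _ _) _; rewrite mulrDl mul1r lerD//.
rewrite normrM distrC ger0_norm ?divr_ge0 ?(ltW qx')//.
rewrite ler_pM ?divr_ge0 ?(ltW qx')//.
by rewrite ler_pdivrMr.
Qed.

End metric_lemmas.

Section ends_of_a_quasigeodesic.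
Context {R : realType} {X : metricType R}.
Variables (sigma : R -> X) (L b T : R).
Hypotheses (L0 : 0 < L) (b0 : 0 < b) (T0 : 0 < T) (TLb : L * b <= T).
Hypothesis qg : forall t t' : R,
  L^-1 * `|t - t'| - b <= mdist (sigma t) (sigma t') <= L * `|t - t'| + b.

Let x0 := sigma 0.
Let m x := Num.max (mdist x0 x) T.
Let E := [set t : R | t <= - T].
Let dE x := inf [set mdist x (sigma t) | t in E].

Let infE x : has_inf [set mdist x (sigma t) | t in E].
Proof.
split; first by exists (mdist x (sigma (- T))); exists (- T) => //; exact: lexx.
by exists 0 => _ [y _ <-]; exact: mdist_ge0.
Qed.

Let dE_le x t : t <= - T -> dE x <= mdist x (sigma t).
Proof. by move=> tT; apply: ge_inf; [case: (infE x) | exists t]. Qed.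

Let dE_ge0 x : 0 <= dE x.
Proof.
apply: lb_le_inf; first by case: (infE x).
by move=> _ [t _ <-]; exact: mdist_ge0.
Qed.

Let dE_lip x x' : `|dE x - dE x'| <= mdist x x'.
Proof.
have D1 y y' : dE y <= mdist y y' + dE y'.
  rewrite -lerBlDl; apply: lb_le_inf; first by case: (infE y').
  move=> _ [t tT <-]; have := dE_le y tT; have := metric_triangle y y' (sigma t); lra.
have := D1 x x'; have := D1 x' x; rewrite (metric_sym x' x) ler_norml => *; lra.
Qed.

Let m_lip x x' : `|m x - m x'| <= mdist x x'.
Proof.
have := mdist_triangle_norm x0 x x'; rewrite /m !ler_norml.
by case: (leP (mdist x0 x)); case: (leP (mdist x0 x')) => *; lra.
Qed.

(** The ratio of the distance to the negative end by the distance to [sigma 0]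
    separates both ends, and its Lipschitz constant decays like the inverse of
    the distance to [sigma 0]. *)
Lemma quasi_geodesic_separating_function : exists v : X -> R, exists2 A, 0 < A &
  [/\ forall x x', `|v x - v x'| <= A / Num.max (mdist x0 x) T * mdist x x',
     forall t, t <= - T -> v (sigma t) = 0 &
     forall t, T <= t -> 1 <= v (sigma t)].
Proof.
have T0' := T0; have Li0 : 0 < L^-1 by rewrite invr_gt0.
have Lb : b <= L^-1 * T by rewrite mulrC ler_pdivlMr// mulrC.
pose A1 := 1 + (L * T + b) / T.
have A10 : 0 < A1 by rewrite addr_gt0// divr_gt0// addr_gt0// mulr_gt0.
have m0 x : 0 < m x by rewrite lt_max T0 orbT.
have dEm x : dE x <= A1 * m x.
  have TT : - T <= - T by [].
  have := dE_le x TT; have := metric_triangle x x0 (sigma (- T)).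
  have /andP[_] := qg 0 (- T); rewrite sub0r opprK gtr0_norm// -/x0.
  have mT : T <= m x by rewrite le_max lexx orbT.
  have md : mdist x x0 <= m x by rewrite metric_sym le_max lexx.
  have : L * T + b <= (L * T + b) / T * m x.
    have LTb : 0 < L * T + b by rewrite addr_gt0// mulr_gt0.
    by rewrite mulrAC ler_pdivlMr// ler_pM2l.
  have -> : A1 * m x = m x + (L * T + b) / T * m x by rewrite /A1 mulrDl mul1r.
  by lra.
pose kap := L^-1 / (L + L^-1 + 1).
have S0 : 0 < L + L^-1 + 1 by rewrite !addr_gt0.
have kap0 : 0 < kap by rewrite divr_gt0.
exists (fun x => dE x / m x / kap), ((1 + A1) / kap).
  by rewrite divr_gt0// addr_gt0.
split.
- move=> x x'; rewrite -mulrBl normrM [`|kap^-1|]gtr0_norm ?invr_gt0//.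
  have -> : (1 + A1) / kap / Num.max (mdist x0 x) T * mdist x x' =
      (1 + A1) / m x * mdist x x' / kap.
    by rewrite /m; ring.
  rewrite ler_wpM2r ?invr_ge0 ?(ltW kap0)//.
  by apply: ratio_lipschitz => //; rewrite dE_ge0 dEm.
- move=> t tT; have := dE_le (sigma t) tT; rewrite mdistxx => H.
  have -> : dE (sigma t) = 0 by apply/eqP; rewrite eq_le H dE_ge0.
  by rewrite !mul0r.
- move=> t Tt; have t0 : 0 < t by exact: lt_le_trans Tt.
  rewrite ler_pdivlMr// mul1r ler_pdivlMr//.
  have LtT : L^-1 * T <= L^-1 * t by rewrite ler_pM2l.
  have d1 : L^-1 * t <= dE (sigma t).
    apply: lb_le_inf; first by case: (infE (sigma t)).
    move=> _ [t' t'T <-]; rewrite /E /= in t'T; have /andP[+ _] := qg t t'.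
    have tt' : t + T <= t - t' by lra.
    rewrite gtr0_norm; last by lra.
    have : L^-1 * (t + T) <= L^-1 * (t - t') by rewrite ler_pM2l.
    by rewrite mulrDr; lra.
  apply: le_trans d1; rewrite /kap mulrAC ler_pdivrMr// -mulrA ler_wpM2l ?(ltW Li0)//.
  rewrite /m ge_max; apply/andP; split.
    have /andP[_] := qg 0 t; rewrite sub0r normrN gtr0_norm//.
    by rewrite !mulrDr mulr1 -/x0 (mulrC t L) (mulrC t L^-1); lra.
  rewrite !mulrDr mulr1; have := mulr_gt0 t0 L0; have := mulr_gt0 t0 Li0; lra.
Qed.

End ends_of_a_quasigeodesic.

Lemma continuum_image {R : realType} {X Y : metricType R} (sigma : R -> X)
    (f : X -> Y) (a b : R) : continuous sigma -> continuous f ->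
  continuum ((f \o sigma) @` `[a, b]).
Proof.
move=> sc fc; have c : {within `[a, b], continuous (f \o sigma)}.
  by apply: continuous_subspaceT => t; apply: continuous_comp; [exact: sc|exact: fc].
split; first by apply: continuous_compact => //; exact: segment_compact.
by apply: connected_continuous_connected => //; exact: segment_connected.
Qed.

(** * Quasiconformal inequivalence *)

Theorem theorem1p1 (R : realType) (Q : R) (hQ : 1 < Q)
    (X : pmetricType R) (muX : {outer_measure set X -> \bar R})
    (hX : metric_measure_space muX)
    (hXgeom : locally_bounded_geometry muX Q)
    (sigma : R -> X) (hsigma_cont : continuous sigma)
    (hsigma : quasi_geodesic sigma)
    (hgrowth : exists R0 N C0 : R, [/\ 0 < R0, N < Q, 0 < C0 &
       forall r : R, R0 <= r -> (muX (ball (sigma 0%R) r) <= (C0 * r `^ N)%:E)%E])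
    (Y : pmetricType R) (muY : {outer_measure set Y -> \bar R})
    (hY : metric_measure_space muY)
    (hYproper : proper_metric Y)
    (hYgeom : locally_bounded_geometry muY Q)
    (hYloewner : loewner_function muY Q t @[t --> 0^'+] --> +oo%E) :
  ~ exists f : X -> Y, quasiconformal f.
Proof.
move=> [f qcf]; have [fc [g [fg gf gc]]] := qcf.1.
have [K K1 weak_qs] := quasiconformal_weak_quasisymmetry qcf.
have [L [b [L0 b0 qg]]] := hsigma.
have [R0 [N [C0 [R00 NQ C00 growth]]]] := hgrowth.
have Q0 : 0 < Q by exact: lt_trans hQ.
have Li0 : 0 < L^-1 by rewrite invr_gt0.
(* Beyond [T] the growth bound holds and both ends of [sigma] are disjoint. *)
pose T := Num.max R0 (L * b).
have T0 : 0 < T by rewrite lt_max R00.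
have R0T : R0 <= T by rewrite le_max lexx.
have LbT : L * b <= T by rewrite le_max lexx orbT.
have bT : b <= L^-1 * T by rewrite mulrC ler_pdivlMr// mulrC.
have bt t : T <= t -> L^-1 * T <= L^-1 * t by move=> Tt; rewrite ler_pM2l.
have Xn (x : X) : exists y, x != y.
  apply: contrapT => nx.
  have xx y : y = x.
    by apply: contrapT => yx; apply: nx; exists y; apply/eqP => xy; apply: yx.
  have /andP[+ _] := qg 0 (2 * T).
  rewrite (xx (sigma _)) (xx (sigma (2 * T))) mdistxx sub0r normrN gtr0_norm ?mulr_gt0//.
  by rewrite mulrCA; lra.
have Yn (y : Y) : exists z, y != z.
  have [x gx] := Xn (g y); exists (f x); apply/eqP => yfx.
  by move/eqP: gx; apply; rewrite yfx fg.
have [cX [CX [cX0 CX0 massX]]] := ball_mass_bounds Q0 hX.1 hXgeom Xn.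
have [cY [CY [cY0 CY0 massY]]] := ball_mass_bounds Q0 hY.1 hYgeom Yn.
have {CX CX0} massX x : exists2 r0 : R, 0 < r0 & forall r : R, 0 < r -> r <= r0 ->
    ((cX * r `^ Q)%:E <= muX (ball x r))%E.
  have [r0 r00 Hr0] := massX x; exists r0 => // r rpos rr0.
  by have /andP[] := Hr0 r rpos rr0.
have sepY : separable Y by case: hYgeom.
have [v [A A0 [vlip vE vF]]] :=
  quasi_geodesic_separating_function L0 b0 T0 LbT qg.
have growthT r : T <= r -> (muX (ball (sigma 0%R) r) <= (C0 * r `^ N)%:E)%E.
  by move=> Tr; apply: growth; exact: le_trans Tr.
have [WX packX] := packing_bound_growth hX.1 Q0 NQ (ltW C00) T0 A0 growthT.
have finY : forall y r, (muY (ball y r) < +oo)%E.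
  apply: proper_ball_finite_mass => // y; have [r0 r00 Hr0] := massY y.
  exists r0 => //; have /andP[_ H] := Hr0 r0 r00 (lexx _).
  exact: le_lt_trans H (ltry _).
have [h [WY [h0 packY]]] := positive_packing hY.1 finY.
pose w x := A / Num.max (mdist (sigma 0) x) T.
have w0 x : 0 < w x by rewrite divr_gt0// lt_max T0 orbT.
have modulus_le := quasiconformal_modulus_le Q0 hY.1 fc gc fg gf K1 weak_qs
  cX0 cY0 CY0 massX massY sepY w0 h0 vlip packX packY.
move: modulus_le; set B := (_ + _)%R => modulus_le.
(* Both ends of the quasi-geodesic leave every ball of [Y]. *)
have escape (p : Y) (l : R) : exists2 M, T <= M & forall S, M <= `|S| ->
    l < mdist p (f (sigma S)).
  have [M HM] := compact_mdist_bounded (sigma 0) gc (hYproper p l).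
  exists (Num.max T (L * (M + b + 1))); first by rewrite le_max lexx.
  move=> S; rewrite ge_max => /andP[_ MS].
  rewrite ltNge; apply/negP => /HM; rewrite fg.
  have /andP[+ _] := qg 0 S; rewrite sub0r normrN.
  have : M + b + 1 <= L^-1 * `|S| by rewrite mulrC ler_pdivlMr// mulrC.
  by lra.
(* [t] is a relative distance at which the Loewner function exceeds the bound [B]
   for the modulus, and the arcs are prolonged until their relative distance is at
   most [t]. *)
have [t [t0 Bt]] : exists t, 0 < t /\ ((B + 1)%:E <= loewner_function muY Q t)%E.
  have /cvgeyPge/(_ (B + 1)) H := hYloewner.
  have : \forall t \near (0 : R)^'+, 0 < t /\ ((B + 1)%:E <= loewner_function muY Q t)%E.
    by near=> t; split; near: t; [exact: nbhs_right_gt | exact: H].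
  by move=> /filter_ex[t Ht]; exists t.
pose p := f (sigma (- T)); pose q := f (sigma T).
pose l := mdist p q / t.
have [M1 TM1 HM1] := escape p l; have [M2 TM2 HM2] := escape q l.
pose S := Num.max M1 M2.
have M1S : M1 <= S by rewrite le_max lexx.
have M2S : M2 <= S by rewrite le_max lexx orbT.
have TS : T <= S by exact: le_trans M1S.
have S0 : 0 < S by exact: lt_le_trans TS.
pose E := (f \o sigma) @` `[- S, - T]; pose F := (f \o sigma) @` `[T, S].
have ET : E p by exists (- T) => //=; rewrite in_itv /= !lerN2 TS lexx.
have ES : E (f (sigma (- S))) by exists (- S) => //=; rewrite in_itv /= !lerN2 TS lexx.
have FT : F q by exists T => //=; rewrite in_itv /= TS lexx.
have FS : F (f (sigma S)) by exists S => //=; rewrite in_itv /= TS lexx.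
have cE : continuum E by exact: continuum_image.
have cF : continuum F by exact: continuum_image.
have [d d0 dEF] : exists2 d, 0 < d & forall x y, E x -> F y -> d <= mdist x y.
  apply: compact_separated; [by case: cE | by exists p | by exists q |].
  move=> _ [s /= sE <-].
  have /metricType_numDomainType.cvgrPdist_lt/(_ _ b0) := @gc (f (sigma s)).
  move=> /nbhs_ballP[d /= d0 Hd]; exists d => // _ [s' /= sF <-].
  rewrite leNgt; apply/negP => dss'.
  have := Hd (f (sigma s')); rewrite ballEmdist /= !fg => /(_ dss').
  move: sE sF; rewrite !in_itv /= => /andP[_ sT] /andP[Ts' _].
  have /andP[+ _] := qg s s'; rewrite ler0_norm; last by lra.
  have : L^-1 * (2 * T) <= L^-1 * - (s - s') by rewrite ler_pM2l//; lra.
  by rewrite mulrCA; lra.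
have EF : relatively_close t E F.
  apply: (@relatively_closeI _ _ E F t d l p q p (f (sigma (- S))) q (f (sigma S))) => //.
  - by rewrite /l mulrCA mulfV ?mulr1// gt_eqF.
  - by apply/ltW/HM1; rewrite normrN gtr0_norm.
  - by apply/ltW/HM2; rewrite gtr0_norm.
have lower : ((B + 1)%:E <= modulus muY Q (connecting_curves E F))%E.
  by apply: le_trans Bt _; apply: ereal_inf_lbound; exists E, F.
have upper : (modulus muY Q (connecting_curves E F) <= B%:E)%E.
  apply: (modulus_le d) => // gamma [gac Eg Fg]; split => //; first exact: dEF.
  case: Eg => s /= sE <-; case: Fg => s' /= sF <-; rewrite !fg.
  move: sE sF; rewrite !in_itv /= => /andP[_ sT] /andP[Ts' _].
  by rewrite (vE _ sT) subr0 (le_trans (vF _ Ts'))// ler_norm.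
by have := le_trans lower upper; rewrite lee_fin; lra.
Unshelve. all: by end_near.
Qed.
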